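(* Every Brownian motion $X$ on a finite metric graph $(\mathcal{G},d)$ is a Feller process; that is, its semigroup $U_tf(\xi)=E_\xi\bigl(f(X_t)\bigr)$ restricts to a Feller semigroup on $C_0(\mathcal{G})$.
   Context: **Metric graphs.** A finite metric graph $(\mathcal{G},d)$ is given by a quadruple $(V,\mathcal{I},\mathcal{E},\partial)$: $V$ is a finite set of vertices, $\mathcal{I}$ a finite set of internal edges, $\mathcal{E}$ a finite set of external edges, $\mathcal{L}=\mathcal{I}\cup\mathcal{E}$, and $\partial$ maps $i\in\mathcal{I}$ to an ordered pair $(\partial^-(i),\partial^+(i))\in V\times V$ (initial and final vertex of $i$) and $e\in\mathcal{E}$ to a vertex $\partial(e)\in V$ (initial vertex of $e$). Each edge $l$ is isometrically identified with an interval $I_l$: $I_e=[0,+\infty)$ for $e\in\mathcal{E}$, with $\partial(e)$ corresponding to $0$, and $I_i=[0,\rho_i]$, $\rho_i>0$, for $i\in\mathcal{I}$, with $\partial^-(i)$ corresponding to $0$ and $\partial^+(i)$ to $\rho_i$. $\mathcal{G}$ is identified with the union of these intervals, with endpoints corresponding to the same vertex identified. $d$ is the metric given by the minimal length of walks between two points along the edges. $\mathcal{G}^\circ=\mathcal{G}\setminus V$; each $\xi\in\mathcal{G}^\circ$ has local coordinates $(l,x)$, $l\in\mathcal{L}$, $x$ in the interior $I_l^\circ$ of $I_l$. $C_0(\mathcal{G})$ is the Banach space of real-valued continuous functions on $\mathcal{G}$ vanishing at infinity, with sup-norm; $B(\mathcal{G})$ is the space of bounded measurable real-valued functions. **Brownian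 motion on $\mathcal{G}$.** Let $\mathcal{G}^\Delta=\mathcal{G}\cup\{\Delta\}$ with a cemetery point $\Delta\notin\mathcal{G}$ adjoined as an isolated point; functions $f$ on $\mathcal{G}$ are extended by $f(\Delta)=0$. A Brownian motion on $\mathcal{G}$ is a time-homogeneous strong Markov process $X=(X_t,\,t\ge0)$ with state space $\mathcal{G}^\Delta$ on a measurable space $(\Omega,\mathcal{A})$ with probability measures $(P_\xi,\,\xi\in\mathcal{G})$, relative to a filtration $(\mathcal{F}_t)$ that is right continuous and complete for $(P_\xi)$, with a (measurable) transition function and shift operators $\theta_s$ ($X_t\circ\theta_s=X_{t+s}$), such that: - it is normal, i.e. $P_\xi(X_0=\xi)=1$ for all $\xi\in\mathcal{G}$, and $\Delta$ is absorbing; - the sample paths are right continuous with left limits in $\mathcal{G}$, and are continuous on $[0,\zeta)$, where $\zeta=\inf\{t\ge0:X_t=\Delta\}$ is the lifetime; - for every $\xi\in\mathcal{G}^\circ$ with local coordinates $(l,x)$, the process $(X(t\wedge H_V),\,t\ge0)$ under $P_\xi$, where $H_V=\inf\{t>0: X_t\in V\}$, is equivalent (same finite-dimensional distributions, under the identification of $l$ with $I_l$) to the absorbed Brownian motion on $I_l$ started in $x$, i.e. to a standard one-dimensional Brownian motion started in $x$ and stopped when it first hits the endpoint(s) of $I_l$ ($\{0,\rho_l\}$ if $l\in\mathcal{I}$, $\{0\}$ if $l\in\mathcal{E}$). **Feller semigroup.** A Feller semigroup on $C_0(\mathcal{G})$ is a family $U=(U_t,\,t\ge0)$ of positive linear operators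 from $C_0(\mathcal{G})$ into itself such that $U_0=\mathrm{id}$ and $\|U_t\|\le1$ for every $t\ge0$; $U_{t+s}=U_t\circ U_s$ for all $s,t\ge0$; and $\lim_{t\downarrow0}\|U_tf-f\|=0$ for every $f\in C_0(\mathcal{G})$. *)

(* Defs.v *)
From HB Require Import structures.
From mathcomp Require Import all_boot all_order all_algebra.
From mathcomp Require Import all_classical all_reals all_analysis.
From mathcomp Require Import measurable_realfun.

Set Implicit Arguments.
Unset Strict Implicit.
Unset Printing Implicit Defensive.
Import Order.TTheory GRing.Theory Num.Theory.
Import numFieldNormedType.Exports.
Local Open Scope classical_set_scope.
Local Open Scope ring_scope.

Record metric_graph (R : realType) := MetricGraph {
  vertex : finType;
  iedge : finType;
  eedge : finType;
  ibdry : iedge -> vertex * vertex;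
  ebdry : eedge -> vertex;
  ilen : iedge -> R;
  ilen_gt0 : forall i, 0 < ilen i
}.

Section Graph.
Context {R : realType}.
Implicit Type G : metric_graph R.

Definition edge G : Type := (iedge G + eedge G)%type.

Definition edge_interval G (l : edge G) : interval R :=
  match l with inl i => `[0, ilen i] | inr _ => `[0, +oo[ end.

Definition edge_interior G (l : edge G) : interval R :=
  match l with inl i => `]0, ilen i[ | inr _ => `]0, +oo[ end.

Definition edge_endpoints G (l : edge G) : set R :=
  match l with inl i => [set 0; ilen i] | inr _ => [set 0] end.

Definition edge_initial G (l : edge G) : vertex G :=
  match l with inl i => (ibdry i).1 | inr e => ebdry e end.

(* An external edge has no final vertex; the value given there is never
   reached by [edge_point] on the interval of that edge. *)
Definition edge_final G (l : edge G) : vertex G :=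
  match l with inl i => (ibdry i).2 | inr e => ebdry e end.

(* The quotient of the disjoint union of the edge intervals that glues endpoints
   lying at the same vertex, given by its normal forms: a point is either a
   vertex or a point of the interior of exactly one edge. *)
Inductive gpoint G : Type :=
| Vertex of vertex G
| Inner (l : edge G) (x : R) of x \in edge_interior l.

(* The identification of the interval of [l] with the edge [l] of the graph; it
   is injective on [edge_interval l], except that it identifies the two
   endpoints of a loop. Only the values on [edge_interval l] are meaningful. *)
Definition edge_point G (l : edge G) (x : R) : gpoint G :=
  match @idP (x \in edge_interior l) with
  | ReflectT h => Inner h
  | ReflectF _ => Vertex (if x <= 0 then edge_initial l else edge_final l)
  end.

(* [walk p q r]: some walk along the edges leads from [p] to [q] and has
   length [r]. *)
Inductive walk G (p : gpoint G) : gpoint G -> R -> Prop :=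
| walk_nil : walk p p 0
| walk_step (l : edge G) (x y r : R) :
    x \in edge_interval l -> y \in edge_interval l ->
    walk p (edge_point l x) r -> walk p (edge_point l y) (r + `|x - y|).

(* Infinite between points of different connected components. *)
Definition gdist G (p q : gpoint G) : \bar R :=
  ereal_inf [set r%:E | r in walk p q].

Lemma walk_cat G (p q s : gpoint G) a b :
  walk p q a -> walk q s b -> walk p s (a + b).
Proof.
move=> pq; elim=> [|l x y r xl yl _ ih]; first by rewrite addr0.
by rewrite addrA; exact: walk_step.
Qed.

Lemma walk_sym G (p q : gpoint G) a : walk p q a -> walk q p a.
Proof.
elim=> [|l x y r xl yl _ ih]; first exact: walk_nil.
rewrite addrC; apply: walk_cat ih.
by rewrite -[`|_|]add0r distrC; apply: walk_step => //; exact: walk_nil.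
Qed.

Definition gball G (p : gpoint G) (e : R) (q : gpoint G) : Prop :=
  (gdist p q < e%:E)%E.

Lemma gballP G (p q : gpoint G) e :
  gball p e q <-> exists2 r, walk p q r & r < e.
Proof.
split=> [|[r pq re]].
  by move=> /ereal_inf_lt[_ [r pq <-]]; rewrite lte_fin => re; exists r.
apply: (@le_lt_trans _ _ r%:E); last by rewrite lte_fin.
by apply: ereal_inf_lbound; exists r.
Qed.

Lemma gball_center G (p : gpoint G) (e : R) : 0 < e -> gball p e p.
Proof. by move=> e0; apply/gballP; exists 0 => //; exact: walk_nil. Qed.

Lemma gball_sym G (p q : gpoint G) (e : R) : gball p e q -> gball q e p.
Proof. by move=> /gballP[r /walk_sym ? ?]; apply/gballP; exists r. Qed.

Lemma gball_triangle G (p q s : gpoint G) (e1 e2 : R) :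
  gball p e1 q -> gball q e2 s -> gball p (e1 + e2) s.
Proof.
move=> /gballP[a pq ae1] /gballP[b qs be2]; apply/gballP.
by exists (a + b); [exact: walk_cat qs|exact: ltrD].
Qed.

HB.instance Definition _ G := gen_eqMixin (gpoint G).
HB.instance Definition _ G := gen_choiceMixin (gpoint G).
HB.instance Definition _ G :=
  hasNbhs.Build (gpoint G) (nbhs_ (entourage_ (@gball G))).
HB.instance Definition _ G := Nbhs_isPseudoMetric.Build R (gpoint G)
  erefl (@gball_center G) (@gball_sym G) (@gball_triangle G) erefl.

End Graph.

(* [None] is the cemetery point. *)
Definition cemetery (T : Type) : Type := option T.

Section CemeteryTopology.
Context {T : topologicalType}.

(* [[set None]] is open: the cemetery point is isolated. *)
Definition cemetery_open (A : set (cemetery T)) : Prop :=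
  open (Some @^-1` A : set T).

Lemma cemetery_openT : cemetery_open setT.
Proof. exact: openT. Qed.

Lemma cemetery_openI : setI_closed cemetery_open.
Proof. by move=> A B; exact: openI. Qed.

Lemma cemetery_open_bigU (I : Type) (f : I -> set (cemetery T)) :
  (forall i, cemetery_open (f i)) -> cemetery_open (\bigcup_i f i).
Proof.
move=> fo; rewrite /cemetery_open preimage_bigcup.
by apply: bigcup_open => i _; exact: fo.
Qed.

HB.instance Definition _ := Choice.copy (cemetery T) (option T).
HB.instance Definition _ := isOpenTopological.Build (cemetery T)
  cemetery_openT cemetery_openI cemetery_open_bigU.

End CemeteryTopology.

Definition ext0 (R : realType) (T : Type) (f : T -> R) (p : cemetery T) : R :=
  if p is Some x then f x else 0.

Definition borel (T : topologicalType) : set (set T) := <<s open >>.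
Arguments borel : clear implicits.

Definition measurable_wrt (T U : Type) (S : set (set T)) (S' : set (set U))
  (f : T -> U) : Prop := forall B, S' B -> S (f @^-1` B).

Definition bounded_measurable (R : realType) (T : topologicalType)
    (f : T -> R) : Prop :=
  measurable_wrt (borel T) measurable f /\ exists M, forall x, `|f x| <= M.

(* Processes and filtrations are indexed by [t : R]; their values at negative
   times are never used. *)

Section Processes.
Context {R : realType} {d : measure_display} {Omega : measurableType d}.

(* [inf {t > 0 | Z_t \in A}], equal to [+oo] if there is no such [t]. *)
Definition hitting_time (E : Type) (Z : R -> Omega -> E) (A : set E)
    (w : Omega) : \bar R :=
  ereal_inf [set t%:E | t in [set t | 0 < t /\ A (Z t w)]].

Definition stopped (E : Type) (Z : R -> Omega -> E) (T : Omega -> \bar R)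
    (t : R) (w : Omega) : E :=
  Z (fine (Order.min t%:E (T w))) w.

Definition lifetime (E : Type) (X : R -> Omega -> cemetery E)
    (w : Omega) : \bar R :=
  ereal_inf [set t%:E | t in [set t | 0 <= t /\ X t w = None]].

(* [X_T], with the convention that [X] is in the cemetery at time [+oo]. *)
Definition at_time (E : Type) (X : R -> Omega -> cemetery E)
    (T : Omega -> \bar R) (w : Omega) : cemetery E :=
  if T w is t%:E then X t w else None.

Record filtration (F : R -> set (set Omega)) : Prop := {
  filtration_sigma : forall t : R, 0 <= t -> sigma_algebra setT (F t);
  filtration_sub : forall t : R, 0 <= t -> F t `<=` measurable;
  filtration_le : forall s t : R, 0 <= s -> s <= t -> F s `<=` F t
}.

Definition right_continuous_filtration (F : R -> set (set Omega)) : Prop :=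
  forall t : R, 0 <= t -> F t = \bigcap_(s in [set s | t < s]) F s.

(* Every [F t] is the intersection over [xi] of its [P xi]-completions. *)
Definition complete_filtration (I : Type) (P : I -> probability Omega R)
    (F : R -> set (set Omega)) : Prop :=
  forall (t : R) A, 0 <= t ->
    (forall xi, exists2 B, F t B & (P xi).-negligible (A `+` B)) -> F t A.

Definition stopping_time (F : R -> set (set Omega)) (T : Omega -> \bar R) :
    Prop :=
  (forall w, (0 <= T w)%E) /\
  (forall t : R, 0 <= t -> F t [set w | (T w <= t%:E)%E]).

Definition stopped_sigma (F : R -> set (set Omega)) (T : Omega -> \bar R) :
    set (set Omega) :=
  [set A | measurable A /\
           forall t : R, 0 <= t -> F t (A `&` [set w | (T w <= t%:E)%E])].

Definition is_conditional_expectation (Q : probability Omega R)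
    (H : set (set Omega)) (Y Z : Omega -> R) : Prop :=
  [/\ Q.-integrable setT (EFin \o Y),
      measurable_wrt H measurable Z,
      Q.-integrable setT (EFin \o Z) &
      forall A, H A -> \int[Q]_(w in A) Y w = \int[Q]_(w in A) Z w].

Definition transition_semigroup (E : Type) (P : E -> probability Omega R)
    (X : R -> Omega -> cemetery E) (t : R) (f : E -> R) (xi : E) : R :=
  fine 'E_(P xi)[ext0 f \o X t].

(* E_xi(f(X_{T+t}) | F_T) = E_{X_T}(f(X_t)), where f(Delta) = 0 and hence
   E_Delta(f(X_t)) = 0 since Delta is absorbing. *)
Definition strong_markov (E : topologicalType) (P : E -> probability Omega R)
    (F : R -> set (set Omega)) (X : R -> Omega -> cemetery E) : Prop :=
  forall (T : Omega -> \bar R) (xi : E) (t : R) (f : E -> R),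
    stopping_time F T -> 0 <= t -> bounded_measurable f ->
    is_conditional_expectation (P xi) (stopped_sigma F T)
      (ext0 f \o at_time X (fun w => T w + t%:E)%E)
      (ext0 (transition_semigroup P X t f) \o at_time X T).

Record standard_brownian (Q : probability Omega R) (W : R -> Omega -> R)
    (x : R) : Prop := {
  sb_measurable : forall t : R, 0 <= t -> measurable_fun setT (W t);
  sb_start : Q [set w | W 0 w = x] = 1%E;
  sb_continuous : forall w, {within `[0, +oo[, continuous (fun t => W t w)};
  sb_gaussian : forall (s t : R) (B : set R), 0 <= s -> s < t -> measurable B ->
    Q [set w | B (W t w - W s w)] = normal_prob 0 (Num.sqrt (t - s)) B;
  sb_independent : forall (n : nat) (t : nat -> R) (B : nat -> set R),
    0 <= t 0%N -> (forall i, t i <= t i.+1) -> (forall i, measurable (B i)) ->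
    Q [set w | forall i, (i < n)%N -> B i (W (t i.+1) w - W (t i) w)] =
    (\prod_(i < n) Q [set w | B i (W (t i.+1) w - W (t i) w)%R])%E
}.

End Processes.

(* Equality of the finite-dimensional distributions of two processes with
   values in the same space [E], on possibly different probability spaces. *)
Definition equivalent_processes (R : realType) (E : topologicalType)
    (d1 : measure_display) (O1 : measurableType d1) (P1 : probability O1 R)
    (Y1 : R -> O1 -> E)
    (d2 : measure_display) (O2 : measurableType d2) (P2 : probability O2 R)
    (Y2 : R -> O2 -> E) : Prop :=
  forall (n : nat) (t : 'I_n -> R) (A : 'I_n -> set E),
    (forall i, 0 <= t i) -> (forall i, borel E (A i)) ->
    P1 [set w | forall i, A i (Y1 (t i) w)] =
    P2 [set w | forall i, A i (Y2 (t i) w)].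

Section BrownianMotion.
Context {R : realType} (G : metric_graph R).
Context {d : measure_display} {Omega : measurableType d}.

Definition vertices : set (cemetery (gpoint G)) :=
  [set Some (Vertex v) | v in [set: vertex G]].

(* The absorbed Brownian motion on the interval of [l] is transported to the
   graph by [edge_point l]: for a loop, the two endpoints of the interval
   correspond to the same point of the graph. *)
Definition locally_brownian (P : gpoint G -> probability Omega R)
    (X : R -> Omega -> cemetery (gpoint G)) : Prop :=
  forall (l : edge G) (x : R) (lx : x \in edge_interior l),
    exists (d' : measure_display) (Omega' : measurableType d')
           (Q : probability Omega' R) (W : R -> Omega' -> R),
      standard_brownian Q W x /\
      equivalent_processes
        (P (Inner lx)) (stopped X (hitting_time X vertices))
        Q (fun t w => Some (edge_point l
             (stopped W (hitting_time W (edge_endpoints l)) t w))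
           : cemetery (gpoint G)).

Record brownian_motion (P : gpoint G -> probability Omega R)
    (F : R -> set (set Omega)) (X : R -> Omega -> cemetery (gpoint G))
    (theta : R -> Omega -> Omega) : Prop := {
  bm_filtration : filtration F;
  bm_right_continuous_filtration : right_continuous_filtration F;
  bm_complete_filtration : complete_filtration P F;
  bm_adapted : forall t : R, 0 <= t ->
    measurable_wrt (F t) (borel (cemetery (gpoint G))) (X t);
  bm_transition_measurable : forall (t : R) A, 0 <= t ->
    borel (cemetery (gpoint G)) A ->
    measurable_wrt (borel (gpoint G)) (measurable : set (set \bar R))
      (fun xi => P xi (X t @^-1` A));
  bm_shift : forall (s t : R) w, 0 <= s -> 0 <= t ->
    X t (theta s w) = X (t + s) w;
  bm_strong_markov : strong_markov P F X;
  bm_normal : forall xi, P xi [set w | X 0 w = Some xi] = 1%E;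
  bm_absorbing : forall (s t : R) w,
    0 <= s -> s <= t -> X s w = None -> X t w = None;
  bm_right_continuous : forall w (t : R), 0 <= t ->
    X s w @[s --> t^'+] --> X t w;
  (* Before the lifetime, and at it, this limit lies in the graph since the
     cemetery is isolated. *)
  bm_left_limits : forall w (t : R), 0 < t ->
    exists p : cemetery (gpoint G), X s w @[s --> t^'-] --> p;
  bm_continuous : forall w,
    {within [set t | 0 <= t /\ (t%:E < lifetime X w)%E],
      continuous (fun t => X t w)};
  bm_locally_brownian : locally_brownian P X
}.

End BrownianMotion.

Section Feller.
Context {R : realType} {T : topologicalType}.

Definition C0 : set (T -> R) :=
  [set f | continuous f /\
    forall e : R, 0 < e ->
      exists2 K, compact K & forall x, ~ K x -> `|f x| < e].

(* Real-valued, and equal to [0] if [T] is empty; only used for bounded [f]. *)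
Definition sup_norm (f : T -> R) : R := sup (range (fun x => `|f x|)).

(* [U] may be defined on functions outside [C0]; the conditions only concern
   its restriction to [C0]. *)
Record feller_semigroup (U : R -> (T -> R) -> T -> R) : Prop := {
  feller_C0 : forall (t : R) f, 0 <= t -> C0 f -> C0 (U t f);
  feller_linear : forall (t a : R) f g, 0 <= t -> C0 f -> C0 g ->
    U t (fun x => a * f x + g x) = (fun x => a * U t f x + U t g x);
  feller_positive : forall (t : R) f, 0 <= t -> C0 f ->
    (forall x, 0 <= f x) -> forall x, 0 <= U t f x;
  feller_id : forall f, C0 f -> U 0 f = f;
  feller_contraction : forall (t : R) f, 0 <= t -> C0 f ->
    sup_norm (U t f) <= sup_norm f;
  feller_semigroupD : forall (s t : R) f, 0 <= s -> 0 <= t -> C0 f ->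
    U (t + s) f = U t (U s f);
  feller_continuous : forall f, C0 f ->
    sup_norm (fun x => U t f x - f x) @[t --> 0^'+] --> 0
}.

End Feller.

(* Main.v *)
Require Import Defs.
From mathcomp Require Import all_boot all_order all_algebra.
From mathcomp Require Import all_classical all_reals all_analysis.
From mathcomp Require Import measurable_realfun.
From mathcomp Require Import lra ring.

Set Implicit Arguments.
Unset Strict Implicit.
Unset Printing Implicit Defensive.
Import Order.TTheory GRing.Theory Num.Theory.
Import numFieldNormedType.Exports.
Local Open Scope classical_set_scope.
Local Open Scope ring_scope.

(** Two estimates on one-dimensional Brownian motion and the strong Markov
    property at hitting times give the Feller property directly, without
    resolvents or the Hille-Yosida theorem.

    The first estimate is a bound, uniform in the starting point, for the
    probability that a Brownian path moves by more than [e] before time [t]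
    ([bm_small_oscillation]); it follows from Gaussian tails by chaining over
    dyadic times. The second says that a Brownian path started close to a point
    crosses it almost at once ([bm_crosses_soon]). Both are about finitely many
    times up to an exceptional event, so they pass from the absorbed Brownian
    motion on an edge to the process on the graph, which is only known through
    finite-dimensional distributions before it reaches a vertex ([transfer]).

    The strong Markov property, stated for fixed delays, is turned into a first
    passage estimate with the random delay [t - H] by rounding this delay up to
    a grid and using right continuity of the paths ([markov_compare],
    [first_passage]). The three conclusions that are not formal then follow.

    - Strong continuity ([strong_continuity]): before the process meets a vertex
      it has hardly moved, and [f] is uniformly continuous; after that it is at
      one of finitely many vertices, where pointwise right continuity at time
      zero suffices.

    - Continuity of [U t f] at a point [p0] ([semigroup_continuous]): started
      near [p0] the process hits [p0] within a short time [H], and [U t f] is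
      compared with [U (t - H) f] at [p0]. The required continuity in time is a
      consequence of strong continuity ([semigroup_time_continuous]), which
      avoids any discussion of fixed-time jumps to the cemetery.

    - Vanishing at infinity ([semigroup_vanishes]): far out on an external edge
      the process does not come back before time [t].

    The topology of the graph enters through functions that are 1-Lipschitz along
    each edge: their variation bounds the length of walks from below
    ([glue_lip]), which makes them continuous and identifies small balls
    ([local_distance]). Events about the process are expressed by such functions
    as well, in particular hitting times as hitting times of zero by a real
    process. *)

(** * Coordinates and Lipschitz functions on a metric graph *)

Section EdgeCoordinates.
Context {R : realType}.
Implicit Type G : metric_graph R.

Lemma itv_edge_interval G (l : edge G) (x : R) :
  (x \in edge_interval l) = (0 <= x) && (if l is inl i then x <= ilen i else true).
Proof. by case: l => [i|e]; rewrite /edge_interval in_itv. Qed.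

Lemma itv_edge_interior G (l : edge G) (x : R) :
  (x \in edge_interior l) = (0 < x) && (if l is inl i then x < ilen i else true).
Proof. by case: l => [i|e]; rewrite /edge_interior in_itv. Qed.

Lemma edge_interiorW G (l : edge G) (x : R) :
  x \in edge_interior l -> x \in edge_interval l.
Proof.
rewrite itv_edge_interval itv_edge_interior => /andP[x0 h]; rewrite ltW//=.
by case: l h => // i /ltW.
Qed.

Lemma edge_point_inner G (l : edge G) (x : R) (lx : x \in edge_interior l) :
  edge_point l x = Inner lx.
Proof.
rewrite /edge_point; destruct idP as [h|h]; last by case: h.
by congr Inner; exact: bool_irrelevance.
Qed.

Lemma edge_point_le0 G (l : edge G) (x : R) :
  x <= 0 -> edge_point l x = Vertex (edge_initial l).
Proof.
move=> x0; rewrite /edge_point; destruct idP as [h|h]; last by rewrite x0.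
by exfalso; move: h; rewrite itv_edge_interior ltNge x0.
Qed.

Lemma edge_point_ge G (i : iedge G) (x : R) :
  ilen i <= x -> edge_point (inl i : edge G) x = Vertex (ibdry i).2.
Proof.
move=> ix; rewrite /edge_point; destruct idP as [h|h].
  by exfalso; move: h; rewrite itv_edge_interior/= [x < _]ltNge ix andbF.
by rewrite leNgt (lt_le_trans (ilen_gt0 i) ix).
Qed.

Definition clamp G (l : edge G) (x : R) : R :=
  if l is inl i then Num.max 0 (Num.min (ilen i) x) else Num.max 0 x.

Lemma clampP G (l : edge G) (x : R) : clamp l x \in edge_interval l.
Proof.
rewrite itv_edge_interval; case: l => [i|e] /=; last by rewrite le_max lexx.
by rewrite le_max lexx/= ge_max (ltW (ilen_gt0 i))/= ge_min lexx.
Qed.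

(** Reduces statements about all coordinates to coordinates in the interval. *)
Lemma edge_point_clamp G (l : edge G) (x : R) :
  edge_point l (clamp l x) = edge_point l x.
Proof.
have [x0|x0] := leP x 0.
  rewrite [RHS]edge_point_le0// edge_point_le0//.
  case: l => [i|e] /=; last by rewrite ge_max lexx x0.
  by rewrite ge_max lexx ge_min x0 orbT.
case: l => [i|e] /=; last by rewrite max_r// ltW.
have [xi|xi] := leP x (ilen i); first by rewrite max_r// ltW.
rewrite max_r ?ltW ?ilen_gt0// edge_point_ge ?lexx//.
by rewrite edge_point_ge// ltW.
Qed.

Lemma lip_min (f g : R -> R) :
  (forall x y, `|f x - f y| <= `|x - y|) -> (forall x y, `|g x - g y| <= `|x - y|) ->
  forall x y, `|Num.min (f x) (g x) - Num.min (f y) (g y)| <= `|x - y|.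
Proof.
move=> hf hg x y; have := hf x y; have := hg x y; set d := `|x - y|.
by rewrite !ler_norml /Num.min; do 2 case: ifP => ?; lra.
Qed.

Lemma lip_max (f g : R -> R) :
  (forall x y, `|f x - f y| <= `|x - y|) -> (forall x y, `|g x - g y| <= `|x - y|) ->
  forall x y, `|Num.max (f x) (g x) - Num.max (f y) (g y)| <= `|x - y|.
Proof.
move=> hf hg x y; have := hf x y; have := hg x y; set d := `|x - y|.
by rewrite !ler_norml /Num.max; do 2 case: ifP => ?; lra.
Qed.

Lemma lip_cst (c : R) (x y : R) : `|c - c| <= `|x - y|.
Proof. by rewrite subrr normr0. Qed.

Lemma lip_opp (f : R -> R) : (forall x y, `|f x - f y| <= `|x - y|) ->
  forall x y, `|- f x - - f y| <= `|x - y|.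
Proof. by move=> hf x y; rewrite -opprD normrN. Qed.

Lemma lip_shift (c : R) (x y : R) : `|(x - c) - (y - c)| <= `|x - y|.
Proof. by rewrite opprB addrA subrK. Qed.

Lemma lip_cshift (c : R) (x y : R) : `|(c - x) - (c - y)| <= `|x - y|.
Proof. by rewrite opprB addrC addrA subrK distrC. Qed.

Lemma clamp_lip G (l : edge G) (x y : R) : `|clamp l x - clamp l y| <= `|x - y|.
Proof.
case: l => [i|e]; (apply: (@lip_max (cst 0)) => [{}x {}y|{x y}x y]; first exact: lip_cst).
  by apply: (@lip_min (cst (ilen i)) id) => {x y}x y //; exact: lip_cst.
by [].
Qed.

(** Beyond its interval an edge parametrisation is constant, so it is
    1-Lipschitz, hence continuous, on the whole line. *)
Lemma gball_edge_point G (l : edge G) (x y e : R) :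
  `|x - y| < e -> gball (edge_point l x) e (edge_point l y).
Proof.
move=> xye; apply/gballP; exists `|clamp l x - clamp l y|; last first.
  exact: le_lt_trans (clamp_lip l x y) xye.
rewrite -(edge_point_clamp l x) -(edge_point_clamp l y) -[`|_|]add0r.
by apply: walk_step; [exact: clampP|exact: clampP|exact: walk_nil].
Qed.

Lemma edge_point_continuous G (l : edge G) : continuous (edge_point l : R -> gpoint G).
Proof.
move=> x; apply/cvg_ballP => e e0; 
by apply/nbhs_ballP; exists e => //= y; exact: gball_edge_point.
Qed.

(** Test functions on the graph are built edge by edge. The conditions
    [glueable] make the result 1-Lipschitz along every edge, and hence for the
    path metric. *)
Definition glue G (a : edge G -> R -> R) (b : vertex G -> R) (p : gpoint G) : R :=
  match p with Vertex v => b v | @Inner _ _ l x _ => a l x end.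

Definition glueable G (a : edge G -> R -> R) (b : vertex G -> R) : Prop :=
  [/\ forall l x y, `|a l x - a l y| <= `|x - y|,
      forall l, a l 0 = b (edge_initial l) &
      forall i : iedge G, a (inl i) (ilen i) = b (ibdry i).2].

Lemma glue_edge_point G a b (l : edge G) (x : R) : glueable a b ->
  x \in edge_interval l -> glue a b (edge_point l x) = a l x.
Proof.
move=> [_ a0 ai] lx; have [lx'|] := boolP (x \in edge_interior l).
  by rewrite edge_point_inner.
move: lx; rewrite itv_edge_interval itv_edge_interior => /andP[x0 h].
move: x0; rewrite le_eqVlt => /orP[/eqP <- _|x0].
  by rewrite edge_point_le0//= a0.
rewrite x0/=; case: l h => // i xi; rewrite -leNgt => ix.
have -> : x = ilen i by apply/le_anti/andP.
by rewrite edge_point_ge//= ai.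
Qed.

(** The variation along a walk is at most the length of the walk; this is how
    lower bounds on the distance are obtained without computing geodesics. *)
Lemma glue_lip G a b (p q : gpoint G) (r : R) : glueable a b ->
  walk p q r -> `|glue a b p - glue a b q| <= r.
Proof.
move=> ab; elim=> [|l x y s xl yl _ ih]; first by rewrite subrr normr0.
rewrite (@glue_edge_point _ _ _ l x)// in ih.
rewrite (@glue_edge_point _ _ _ l y)// -(subrKA (a l x)).
rewrite (le_trans (ler_normD _ _))// lerD//.
by case: ab.
Qed.

Lemma glue_gball G a b (p q : gpoint G) (e : R) : glueable a b ->
  gball p e q -> `|glue a b p - glue a b q| < e.
Proof. by move=> ab /gballP[r pq]; apply: le_lt_trans; exact: glue_lip. Qed.

Lemma glue_continuous G a b : glueable a b -> continuous (glue a b : gpoint G -> R).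
Proof.
move=> ab p.
apply/(@cvgrPdist_lt _ _ _ (nbhs p) (nbhs_filter p)) => e e0; 
by apply/nbhs_ballP; exists e => //= q; exact: glue_gball.
Qed.


(** On the interval of the edge, the distance to the nearer endpoint; it is
    negative beyond the interval, so its zeros are exactly the endpoints. *)
Definition tent G (l : edge G) (x : R) : R :=
  if l is inl i then Num.min x (ilen i - x) else x.

Lemma tent_lip G (l : edge G) (x y : R) : `|tent l x - tent l y| <= `|x - y|.
Proof.
case: l => [i|e] //; apply: (@lip_min id (fun z => ilen i - z)) => // {}x {}y.
exact: lip_cshift.
Qed.

Lemma tent0 G (l : edge G) : tent l 0 = 0.
Proof. by case: l => [i|e] //=; rewrite subr0 min_l// ltW// ilen_gt0. Qed.

Lemma tent_ilen G (i : iedge G) : tent (inl i : edge G) (ilen i) = 0.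
Proof. by rewrite /= subrr min_r// ltW// ilen_gt0. Qed.

Lemma tent_gt0 G (l : edge G) (x : R) : (0 < tent l x) = (x \in edge_interior l).
Proof.
rewrite itv_edge_interior; case: l => [i|e] /=; last by rewrite andbT.
by rewrite lt_min subr_gt0.
Qed.

Definition vertex_dist G : gpoint G -> R := glue (@tent G) (fun=> 0).

Lemma vertex_dist_glueable G : glueable (@tent G) (fun=> 0).
Proof. by split; [exact: tent_lip|exact: tent0|exact: tent_ilen]. Qed.

Lemma vertex_dist_eq0 G (p : gpoint G) :
  vertex_dist p = 0 <-> exists v, p = Vertex v.
Proof.
split=> [|[v ->//]]; case: p => [v _|l x lx /= t0]; first by exists v.
by have := lx; rewrite -tent_gt0 t0 ltxx.
Qed.

(** Signed on the edge [l], where it changes sign at [x0], and positive inside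
    the other edges: a path from one side of [x0] to the other that avoids the
    vertices has to pass through [x0]. *)
Definition cross_coord G (l : edge G) (x0 : R) (l' : edge G) (x : R) : R :=
  if pselect (l' = l) then Num.max (- tent l' x) (Num.min (tent l' x) (x - x0))
  else tent l' x.

Lemma cross_glueable G (l : edge G) (x0 : R) : glueable (cross_coord l x0) (fun=> 0).
Proof.
split=> [l' x y|l'|i]; rewrite /cross_coord; case: pselect => /= _.
- apply: (@lip_max (fun z => - tent l' z) (fun z => Num.min (tent l' z) (z - x0))).
    by apply: (@lip_opp (tent l')) => ? ?; exact: tent_lip.
  apply: (@lip_min (tent l') (fun z => z - x0)) => ? ?; first exact: tent_lip.
  exact: lip_shift.
- exact: tent_lip.
- by rewrite tent0 oppr0 max_l// ge_min lexx.
- by rewrite tent0.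
- by have /= -> := tent_ilen i; rewrite oppr0 max_l// ge_min lexx.
- by have /= -> := tent_ilen i.
Qed.

Definition cross G (l : edge G) (x0 : R) : gpoint G -> R :=
  glue (cross_coord l x0) (fun=> 0).

Lemma cross_lt0 G (l : edge G) (x0 x : R) (lx : x \in edge_interior l) :
  (cross l x0 (Inner lx) < 0) = (x < x0).
Proof.
rewrite /= /cross_coord; case: pselect => //= _.
move: lx; rewrite -tent_gt0; move: (tent l x) => t t0.
by rewrite gt_max oppr_lt0 t0/= gt_min lt_gtF//= subr_lt0.
Qed.

Lemma cross_gt0 G (l : edge G) (x0 x : R) (lx : x \in edge_interior l) :
  (0 < cross l x0 (Inner lx)) = (x0 < x).
Proof.
rewrite /= /cross_coord; case: pselect => //= _.
move: lx; rewrite -tent_gt0; move: (tent l x) => t t0.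
by rewrite lt_max oppr_gt0 lt_gtF//= lt_min t0/= subr_gt0.
Qed.

Lemma cross_eq0 G (l : edge G) (x0 : R) (lx0 : x0 \in edge_interior l) (p : gpoint G) :
  cross l x0 p = 0 -> p = Inner lx0 \/ exists v, p = Vertex v.
Proof.
case: p => [v _|l' x lx H]; [by right; exists v|left].
have [e|ne] := pselect (l' = l).
  subst l'; have xx0 : x = x0.
    apply/eqP; rewrite eq_le 2!leNgt -(cross_gt0 x0 lx) -(cross_lt0 x0 lx).
    by rewrite H ltxx.
  by subst x; congr Inner; exact: bool_irrelevance.
move: H; rewrite /= /cross_coord; case: pselect => //= _ t0.
by have := lx; rewrite -tent_gt0 t0 ltxx.
Qed.

End EdgeCoordinates.


(** * Small balls and continuity along edges *)

Section GraphTopology.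
Context {R : realType}.
Implicit Type G : metric_graph R.

(** Used for uniformity over the finitely many edges and vertices. *)
Lemma finite_pos_min (I : finType) (Pr : I -> R -> Prop) :
  (forall i e e', 0 < e' -> e' <= e -> Pr i e -> Pr i e') ->
  (forall i, exists2 e, 0 < e & Pr i e) -> exists2 e, 0 < e & forall i, Pr i e.
Proof.
move=> mono ex.
have : \forall e \near (0 : R)^'+, 0 < e /\ forall i, Pr i e.
  near=> e; split; first by near: e; exact: nbhs_right_gt.
  near: e; apply: (@filter_forall _ _ _ (0 : R)^'+) => i.
  have [e0 e00 Pe0] := ex i; near=> e.
  by apply: (mono i e0) => //; near: e; exact: nbhs_right_le.
by move=> /filter_ex[e []]; exists e.
Unshelve. all: by end_near. Qed.

(** Near [v] this is the distance to [v]; it is cut off at [m], which is at most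
    every edge length. The two branches account for loops at [v]. *)
Definition vertex_near_coord G (v : vertex G) (m : R) (l : edge G) (x : R) : R :=
  Num.min m (Num.min (if edge_initial l == v then x else m)
    (if l is inl i then if (ibdry i).2 == v then ilen i - x else m else m)).

Lemma vertex_near_glueable G (v : vertex G) (m : R) : 0 < m ->
  (forall i : iedge G, m <= ilen i) ->
  glueable (vertex_near_coord v m) (fun w => if w == v then 0 else m).
Proof.
move=> m0 mi; split=> [l x y|[i|e]|i].
- apply: (@lip_min _ (cst m) (fun z => Num.min (if edge_initial l == v then z else m)
    (if l is inl i then if (ibdry i).2 == v then ilen i - z else m else m))) => {}x {}y.
    exact: lip_cst.
  apply: (@lip_min _ (fun z => if edge_initial l == v then z else m)
    (fun z => if l is inl i then if (ibdry i).2 == v then ilen i - z else m else m))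
    => {}x {}y.
    by case: ifP => // _; exact: lip_cst.
  by case: l => [i|e]; [case: ifP => _; [exact: lip_cshift|]|]; exact: lip_cst.
- rewrite /vertex_near_coord /=; have := mi i.
  by rewrite /Num.min; repeat case: ifP; lra.
- by rewrite /vertex_near_coord /= /Num.min; repeat case: ifP; lra.
- rewrite /vertex_near_coord /=; have := mi i.
  by rewrite /Num.min; repeat case: ifP; lra.
Qed.

Definition inner_near_coord G (l : edge G) (x0 : R) (l' : edge G) (x : R) : R :=
  if pselect (l' = l) then Num.min (tent l x0) `|x - x0| else tent l x0.

Lemma tent_le_dist G (l : edge G) (x0 : R) : tent l x0 <= `|0 - x0|.
Proof.
rewrite sub0r normrN; case: l => [i|e] /=; last exact: ler_norm.
by rewrite ge_min ler_norm.
Qed.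

Lemma inner_near_glueable G (l : edge G) (x0 : R) :
  glueable (inner_near_coord l x0) (fun=> tent l x0).
Proof.
split=> [l' x y|l'|i]; rewrite /inner_near_coord; case: pselect => /= h.
- apply: (@lip_min _ (cst (tent l x0)) (fun z => `|z - x0|)) => {}x {}y.
    exact: lip_cst.
  by rewrite (le_trans (ler_dist_dist _ _))// lip_shift.
- exact: lip_cst.
- by rewrite min_l// tent_le_dist.
- by [].
- by rewrite -h/= min_l// ge_min orbC ler_norm.
- by [].
Qed.

(** The graph seen from [p0]: a truncated distance to [p0] that vanishes only
    there, and for which small balls are made of pieces of the edges at [p0].
    There are at most two such pieces on each edge, starting at the coordinates
    [anchor l true] and [anchor l false]. *)
Lemma local_distance G (p0 : gpoint G) : exists (a : edge G -> R -> R)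
    (b : vertex G -> R) (m : R) (anchor : edge G -> bool -> R),
  [/\ 0 < m, glueable a b, forall p, 0 <= glue a b p,
      forall p, glue a b p = 0 <-> p = p0 &
      forall p, glue a b p < m -> p = p0 \/ exists l x j,
        [/\ x \in edge_interior l, anchor l j \in edge_interval l, p = edge_point l x,
            p0 = edge_point l (anchor l j) & `|x - anchor l j| = glue a b p]].
Proof.
case: p0 => [v|l x0 lx0].
  have [m m0 mi] : exists2 m : R, 0 < m & forall i : iedge G, m <= ilen i.
    apply: finite_pos_min => [i e e' _|i]; first exact: le_trans.
    by exists (ilen i); [exact: ilen_gt0|].
  pose anchor (l : edge G) (j : bool) : R := if j then 0 else if l is inl i then ilen i else 0.
  have near p : glue (vertex_near_coord v m) (fun w => if w == v then 0 else m) p < m ->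
      p = Vertex v \/ exists l x j,
        [/\ x \in edge_interior l, anchor l j \in edge_interval l, p = edge_point l x,
            Vertex v = edge_point l (anchor l j) &
            `|x - anchor l j| = glue (vertex_near_coord v m) (fun w => if w == v then 0 else m) p].
    case: p => [w|l x lx] /=; first by case: ifP => [/eqP ->|]; [left|rewrite ltxx].
    move=> xm; right.
    have [x0 xl] : 0 < x /\ forall i : iedge G, l = inl i -> x < ilen i.
      move: lx {xm}; rewrite itv_edge_interior => /andP[? h]; split => // i le.
      by rewrite le in h.
    have : (edge_initial l = v /\ x = vertex_near_coord v m l x) \/
        (exists2 i : iedge G, l = inl i &
          (ibdry i).2 = v /\ ilen i - x = vertex_near_coord v m l x).
      move: xm; rewrite /vertex_near_coord; case: l lx xl => [i|e] lx xl.
        rewrite /Num.min; case: eqP => iv; case: eqP => fv; repeat case: ifP;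
          move=> *; try (by left; split); try (by right; exists i); exfalso; lra.
      rewrite /Num.min; case: eqP => iv; repeat case: ifP;
          move=> *; try (by left; split); exfalso; lra.
    move=> [[iv xe]|[i le [fv xe]]].
      exists l, x, true; split=> //; first by rewrite itv_edge_interval lexx/=; case: (l) => // i; rewrite ltW// ilen_gt0.
      - by rewrite edge_point_inner.
      - by rewrite edge_point_le0// iv.
      - by rewrite subr0 gtr0_norm.
    have al : anchor l false = ilen i by rewrite /anchor le.
    exists l, x, false; rewrite al; split => //.
    - by rewrite itv_edge_interval le lexx ltW// ilen_gt0.
    - by rewrite edge_point_inner.
    - by rewrite le edge_point_ge// fv.
    - by rewrite distrC gtr0_norm ?subr_gt0//; exact: xl.
  exists (vertex_near_coord v m), (fun w => if w == v then 0 else m), m, anchor.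
  split=> //; first exact: vertex_near_glueable.
    case=> [w|l x lx] /=; first by case: ifP; rewrite // ltW.
    have := lx; rewrite /vertex_near_coord itv_edge_interior !le_min (ltW m0)/= => /andP[x0].
    case: l lx => [i|e] lx h; last by case: ifP; rewrite !ltW.
    by case: ifP => _; case: ifP => _; rewrite ?(ltW m0) ?(ltW x0) ?subr_ge0 ?(ltW h).
  move=> p; split=> [p0|->]; last by rewrite /= eqxx.
  have [//|[l [x [j [lx lx0 pE vE]]]]] := near p ltac:(by rewrite p0).
  rewrite p0 => /eqP; rewrite normr_eq0 subr_eq0 => /eqP xx0.
  by rewrite pE xx0.
have t0 : 0 < tent l x0 by rewrite tent_gt0.
have near p : glue (inner_near_coord l x0) (fun=> tent l x0) p < tent l x0 ->
    exists x, [/\ x \in edge_interior l, p = edge_point l x &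
              `|x - x0| = glue (inner_near_coord l x0) (fun=> tent l x0) p].
  case: p => [w|l' x lx] /=; first by rewrite ltxx.
  rewrite /inner_near_coord; case: pselect => [h|h] /=; last by rewrite ltxx.
  subst l'; rewrite gt_min ltxx/= => xm; exists x; split => //.
    by rewrite edge_point_inner.
  by rewrite min_r// ltW.
exists (inner_near_coord l x0), (fun=> tent l x0), (tent l x0), (fun _ _ => x0); split => //.
- exact: inner_near_glueable.
- case=> [w|l' x lx] /=; first exact: ltW.
  by rewrite /inner_near_coord; case: pselect => h/=; rewrite ?le_min !(ltW t0)/=.
- move=> p; split=> [p0|->].
    have [x [lx pE]] := near p ltac:(by rewrite p0).
    rewrite p0 => /eqP; rewrite normr_eq0 subr_eq0 => /eqP xx0.
    by rewrite pE xx0 edge_point_inner.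
  rewrite /= /inner_near_coord; case: pselect => // _ /=.
  by rewrite subrr normr0 min_r// ltW.
- move=> p /near[x [lx pE xx0]]; right; exists l, x, true.
  by split=> //; [exact: edge_interiorW|rewrite edge_point_inner].
Qed.

(** Continuity on the graph is continuity along each edge up to its ends. *)
Lemma continuous_along_edges G (g : gpoint G -> R) :
  (forall (l : edge G) (x0 : R), x0 \in edge_interval l -> forall e : R, 0 < e ->
    exists2 eta, 0 < eta & forall x, x \in edge_interior l -> `|x - x0| < eta ->
      `|g (edge_point l x) - g (edge_point l x0)| < e) ->
  continuous g.
Proof.
move=> gl p0; apply/(@cvgrPdist_lt _ _ _ (nbhs p0) (nbhs_filter p0)) => e e0.
have [a [b [m [anchor [m0 ab _ ab0 near]]]]] := local_distance p0.
have atx0 (l : edge G) (x0 : R) : exists2 eta, 0 < eta & x0 \in edge_interval l ->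
    p0 = edge_point l x0 -> forall x, x \in edge_interior l -> `|x - x0| < eta ->
      `|g (edge_point l x) - g p0| < e.
  have [lx0|lx0] := boolP (x0 \in edge_interval l); last by exists 1.
  have [eta eta0 h] := gl l x0 lx0 e e0.
  by exists eta => // _ ->.
have [eta eta0 h] : exists2 eta, 0 < eta &
    forall lj : (iedge G + eedge G) * bool, let x0 := anchor lj.1 lj.2 in
    x0 \in edge_interval (lj.1 : edge G) -> p0 = edge_point lj.1 x0 ->
    forall x, x \in edge_interior (lj.1 : edge G) ->
    `|x - x0| < eta -> `|g (edge_point lj.1 x) - g p0| < e.
  apply: finite_pos_min => [[l j] d d' _ dd' h|[l j]]; last exact: atx0.
  move=> /= in_l p0E x lx xd; apply: (h in_l p0E x lx); exact: lt_le_trans xd dd'.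
apply/nbhs_ballP; exists (Num.min m eta); first by rewrite /= lt_min m0 eta0.
move=> p /(glue_gball ab); rewrite (ab0 p0).2// sub0r normrN => pm.
have := le_lt_trans (ler_norm _) pm; rewrite lt_min => /andP[/near[->|]].
  by rewrite subrr normr0.
move=> [l [x [j [lx lx0 pE p0E <-]]]] xeta.
by rewrite distrC pE (h (l, j)).
Qed.

End GraphTopology.

(** * Functions vanishing at infinity and Borel measurability *)

Section VanishingFunctions.
Context {R : realType}.
Implicit Type G : metric_graph R.

(** Only the external edges are unbounded, so the coordinate on them decides
    which points are close to infinity. *)
Definition radius_coord G (l : edge G) (x : R) : R := if l is inr _ then x else 0.

Definition radius G : gpoint G -> R := glue (@radius_coord G) (fun=> 0).

Lemma radius_glueable G : glueable (@radius_coord G) (fun=> 0).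
Proof. by split=> [[i|e] x y|[i|e]|i] //=; exact: lip_cst. Qed.

Lemma radius_continuous G : continuous (@radius G).
Proof. by apply: glue_continuous; exact: radius_glueable. Qed.

(** A finite union of vertices and of images of segments. *)
Lemma radius_compact G (M : R) : compact [set p : gpoint G | radius p <= M].
Proof.
have [M0|M0] := leP 0 M; last first.
  rewrite [X in compact X](_ : _ = set0); first exact: compact0.
  apply/seteqP; split => // p /= pM; have : radius p < 0 by exact: le_lt_trans pM M0.
  rewrite ltNge; case: p {pM} => [v|[i|e] x lx] /=; rewrite ?lexx//.
  by have := lx; rewrite itv_edge_interior => /andP[/ltW ->].
apply/compact_near_coveringP => I F Pr FF cov.
have covV (v : vertex G) : \near F, Pr F (Vertex v).
  have [[A B] [/= vA FB] AB] := cov (Vertex v) M0.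
  by apply: filterS FB => i Bi; apply: (AB (_, _)); split => //=; exact: nbhs_singleton.
have covE (l : iedge G + eedge G) : \near F,
    `[0, if l is inl i then ilen i else M] `<=` (fun x => Pr F (edge_point (l : edge G) x)).
  have := @segment_compact R 0 (if l is inl i then ilen i else M).
  move=> /compact_near_coveringP/(_ _ _ (fun i x => Pr i (edge_point (l : edge G) x)) FF).
  apply=> x xl.
  have [|[A B] [/= vA FB] AB] := cov (edge_point (l : edge G) x).
    move: xl; rewrite /= in_itv/= => /andP[x0 xl].
    rewrite /radius (@glue_edge_point _ _ _ _ l)//; first by case: (l) xl.
      exact: radius_glueable.
    by rewrite itv_edge_interval x0/=; case: (l) xl.
  exists ((fun y => edge_point (l : edge G) y) @^-1` A, B).
    by split => //=; exact: edge_point_continuous.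
  by move=> [y i] [/= Ay Bi]; apply: (AB (_, _)).
have hV := @filter_forall _ _ _ F FF covV.
have hE := @filter_forall _ _ _ F FF covE.
apply: filterS2 hV hE => i hV hE p; case: p => [v|l x lx] //= pM.
rewrite -edge_point_inner; apply: (hE l) => /=; rewrite in_itv/=.
move: lx pM; rewrite itv_edge_interior => /andP[/ltW -> h].
by case: l h => [i'|e] //= /ltW ->.
Qed.

Lemma C0I G (g : gpoint G -> R) : continuous g ->
  (forall e : R, 0 < e -> exists M, forall p, M < radius p -> `|g p| < e) -> C0 g.
Proof.
move=> gc gv; split => // e /gv[M hM].
exists [set p : gpoint G | radius p <= M]; first exact: radius_compact.
by move=> p /= /negP; rewrite -ltNge; exact: hM.
Qed.

Lemma C0_radius G (f : gpoint G -> R) (e : R) : C0 f -> 0 < e ->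
  exists M, forall p, M < radius p -> `|f p| < e.
Proof.
move=> [_ /[apply]] [K cK hK].
have : compact (@radius G @` K).
  by apply: continuous_compact => //; apply: continuous_subspaceT; exact: radius_continuous.
move=> /compact_bounded[M0 [_ hM0]]; exists (M0 + 1) => p pM; apply: hK => Kp.
have : `|radius p| <= M0 + 1 by apply: (hM0 (M0 + 1)); [rewrite ltrDl|exists p].
by rewrite leNgt (lt_le_trans pM)// ler_norm.
Qed.

Lemma C0_bounded G (f : gpoint G -> R) : C0 f ->
  exists2 M, 0 < M & forall p, `|f p| <= M.
Proof.
move=> [fc fv]; have [K cK hK] := fv 1 ltr01.
have : compact (f @` K) by apply: continuous_compact => //; exact: continuous_subspaceT.
move=> /compact_bounded[M0 [_ hM0]]; exists (Num.max 1 (M0 + 1)).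
  by rewrite lt_max ltr01.
move=> p; have [Kp|Kp] := pselect (K p); rewrite le_max; last by rewrite ltW ?hK.
by apply/orP; right; apply: (hM0 (M0 + 1)); [rewrite ltrDl|exists p].
Qed.

(** On a compact set outside of which [f] is small this is Heine's theorem, with
    balls around points of the compact set that may leave it. *)
Lemma C0_uniform G (f : gpoint G -> R) (e : R) : C0 f -> 0 < e ->
  exists2 eta, 0 < eta & forall p q, gball p eta q -> `|f p - f q| <= e.
Proof.
move=> [fc fv] e0; have e20 : 0 < e / 2 by rewrite divr_gt0.
have e40 : 0 < e / 2 / 2 by rewrite divr_gt0.
have [K cK hK] := fv _ e20.
have : \forall eta \near (0 : R)^'+, K `<=`
    [set p | forall q, gball p eta q -> `|f p - f q| <= e].
  have /compact_near_coveringP cov := cK.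
  apply: (cov _ _ (fun eta p => forall q, gball p eta q -> `|f p - f q| <= e)) => p Kp.
  have /(@cvgrPdist_lt _ _ _ (nbhs p) (nbhs_filter p)) fp := fc p.
  have /nbhs_ballP[d /= d0 hd] := fp _ e20.
  exists (gball p (d / 2), [set x | x <= d / 2]) => /=.
    split; first by apply: (@nbhsx_ballx _ (gpoint G)); rewrite divr_gt0.
    by apply: nbhs_right_le; rewrite divr_gt0.
  move=> [p' eta] [/= pp' etad] q p'q.
  have pq : gball p d q.
    have /gballP[r pr rd] := gball_triangle pp' p'q; apply/gballP.
    by exists r => //; move: etad rd; rewrite /=; lra.
  have pp : gball p d p'.
    move/gballP: pp' => [r pr rd]; apply/gballP; exists r => //.
    by rewrite (lt_trans rd)// ltr_pdivrMr// ltr_pMr// ltr1n.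
  have := hd _ pq; have := hd _ pp => /= /ltW h1 /ltW h2.
  rewrite -(subrKA (f p)) (splitr e) (le_trans (ler_normD _ _))// lerD//.
  by rewrite distrC.
move=> h; have : \forall eta \near (0 : R)^'+, 0 < eta /\ K `<=`
    [set p | forall q, gball p eta q -> `|f p - f q| <= e].
  near=> eta; split; first by near: eta; exact: nbhs_right_gt.
  by near: eta.
move=> /filter_ex[eta [eta0 hK']]; exists eta => // p q pq.
have [Kp|Kp] := pselect (K p); first exact: hK'.
have [Kq|Kq] := pselect (K q); first by rewrite distrC; apply: hK' => //; exact: gball_sym.
rewrite (splitr e) (le_trans (ler_normB _ _))// lerD// ltW//; exact: hK.
Unshelve. all: by end_near. Qed.

End VanishingFunctions.

Section CemeteryExtension.
Context {R : realType} {T : topologicalType}.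

(** The value at the cemetery is free: it is isolated, so any choice keeps the
    extension continuous, and a nonzero one keeps the cemetery out of zero sets. *)
Definition extc (c : R) (phi : T -> R) (p : cemetery T) : R :=
  if p is Some x then phi x else c.

Lemma extc_continuous (c : R) (phi : T -> R) : continuous phi -> continuous (extc c phi).
Proof.
by move=> /continuousP phic; apply/continuousP => U /phic.
Qed.

Lemma continuous_Some (phi : cemetery T -> R) : continuous phi ->
  continuous (fun x : T => phi (Some x)).
Proof.
by move=> /continuousP phic; apply/continuousP => U /phic.
Qed.

End CemeteryExtension.

Section MeasurableWrt.

Lemma generated_measurable_wrt (T U : Type) (S : set (set T)) (C : set (set U))
    (f : T -> U) : sigma_algebra setT S ->
  (forall B, C B -> S (f @^-1` B)) -> measurable_wrt S <<s C >> f.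
Proof.
move=> sS h; 
have sub : <<s C >> `<=` image_set_system setT f S.
  apply: smallest_sub; first exact: sigma_algebra_image.
  by move=> B CB; rewrite /image_set_system/= setTI; exact: h.
by move=> B /sub; rewrite /image_set_system/= setTI.
Qed.

Lemma borel_sigma (T : topologicalType) : sigma_algebra setT (borel T).
Proof. exact: smallest_sigma_algebra. Qed.

Lemma open_borel (T : topologicalType) (U : set T) : open U -> borel T U.
Proof. exact: sub_sigma_algebra. Qed.

Lemma continuous_borel (R : realType) (T : topologicalType) (phi : T -> R) :
  continuous phi -> measurable_wrt (borel T) measurable phi.
Proof.
move=> /continuousP phic B mB.
have : <<s @RGenOInfty.G R >> B.
  have -> : <<s @RGenOInfty.G R >> = (@RGenOInfty.G R).-sigma.-measurable by [].
  by rewrite -RGenOInfty.measurableE.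
apply: (generated_measurable_wrt (borel_sigma T)) => {mB}B [x ->].
have xo : open (`]x, +oo[%classic : set R) by exact: interval_open.
by have /open_borel := phic _ xo.
Qed.

Lemma comp_measurable_wrt (T U V : Type) (S : set (set T)) (S' : set (set U))
    (S'' : set (set V)) (f : T -> U) (g : U -> V) :
  measurable_wrt S S' f -> measurable_wrt S' S'' g -> measurable_wrt S S'' (g \o f).
Proof. by move=> mf mg B /mg /mf. Qed.

End MeasurableWrt.

(** * Measurability of hitting times and of processes at random times *)

Section SigmaAlgebraOperations.
Context {T : Type} {S : set (set T)} (sS : sigma_algebra setT S).

Lemma sigma_setC (A : set T) : S A -> S (~` A).
Proof. by case: sS => _ SC _ /SC; rewrite setTD. Qed.

Lemma sigma_set0 : S set0. Proof. by case: sS. Qed.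

Lemma sigma_setT : S setT.
Proof. by rewrite -setC0; exact: sigma_setC sigma_set0. Qed.

Lemma sigma_bigcup (I : countType) (F : I -> set T) :
  (forall i, S (F i)) -> S (\bigcup_i F i).
Proof.
move=> SF; case: sS => S0 _ SU.
rewrite (_ : \bigcup_i F i = \bigcup_n (if unpickle n is Some i then F i else set0)).
  by apply: SU => n; case: unpickle.
apply/seteqP; split=> [x [i _ Fx]|x [n _]]; first by exists (pickle i); rewrite ?pickleK.
by case: unpickle => // i Fx; exists i.
Qed.

Lemma sigma_bigcap (I : countType) (F : I -> set T) :
  (forall i, S (F i)) -> S (\bigcap_i F i).
Proof.
move=> SF; rewrite -[X in S X]setCK setC_bigcap.
by apply: sigma_setC; apply: sigma_bigcup => i; exact: sigma_setC.
Qed.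

Lemma sigma_setU (A B : set T) : S A -> S B -> S (A `|` B).
Proof.
move=> SA SB; rewrite (_ : _ `|` _ = \bigcup_(b : bool) (if b then A else B)).
  by apply: sigma_bigcup => -[].
apply/seteqP; split=> [x [?|?]|x [[] _ ?]]; [by exists true|by exists false| |].
  by left.
by right.
Qed.

Lemma sigma_setI (A B : set T) : S A -> S B -> S (A `&` B).
Proof.
move=> SA SB; rewrite -[X in S X]setCK setCI.
by apply/sigma_setC/sigma_setU; exact: sigma_setC.
Qed.

End SigmaAlgebraOperations.

Section HittingMeasurable.
Context {R : realType} {Om : Type} {S : set (set Om)} (sS : sigma_algebra setT S).

(** A real process that is continuous as long as it is alive hits zero at some
    time of an open interval iff it comes arbitrarily close to zero at rational
    times of a compact subinterval at the end of which it is still alive. *)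
Lemma hitting_zero_measurable (Z : R -> Om -> R) (alive : R -> set Om) (t : R) :
  (forall s, 0 < s -> s < t -> measurable_wrt S measurable (Z s)) ->
  (forall s, 0 < s -> s < t -> S (alive s)) ->
  (forall w a c, 0 < a -> alive c w -> {within `[a, c], continuous (fun s => Z s w)}) ->
  (forall w s, 0 < s -> Z s w = 0 -> exists2 u, s < u & forall c, s < c -> c < u -> alive c w) ->
  S [set w | exists s, [/\ 0 < s, s < t & Z s w = 0]].
Proof.
move=> mZ malive cZ Zalive.
pose E := \bigcup_(ac : rat * rat) (if (0 < ratr ac.1 :> R) && (ratr ac.1 < ratr ac.2 :> R) && (ratr ac.2 < t)
  then alive (ratr ac.2) `&` \bigcap_(n : nat) \bigcup_(q : rat)
     (if (ratr ac.1 <= ratr q :> R) && (ratr q <= ratr ac.2 :> R) then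
      Z (ratr q) @^-1` [set x | `|x| < n.+1%:R^-1] else set0) else set0).
have mE : S E.
  apply: (sigma_bigcup sS) => -[a c] /=; case: ifP => [/andP[/andP[a0 ac] ct]|_]; last exact: sigma_set0 sS.
  have c0 : 0 < ratr c :> R by exact: lt_trans a0 ac.
  apply: (sigma_setI sS); first exact: malive.
  apply: (sigma_bigcap sS) => n; apply: (sigma_bigcup sS) => q.
  case: ifP => [/andP[aq qc]|_]; last exact: sigma_set0 sS.
  apply: mZ; [exact: lt_le_trans a0 aq|exact: le_lt_trans qc ct|].
  apply: open_measurable; rewrite openE => x /= xn.
  apply/nbhs_ballP; exists (n.+1%:R^-1 - `|x|); first by rewrite /= subr_gt0.
  move=> y; rewrite /ball/= => xy.
  by rewrite -(subKr x y) (le_lt_trans (ler_normB _ _))// -ltrBrDl.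
suff -> : [set w | exists s, [/\ 0 < s, s < t & Z s w = 0]] = E by [].
apply/seteqP; split=> w.
  move=> [s [s0 st Zs]]; have [u su halive] := Zalive w s s0 Zs.
  have /rat_in_itvoo[a] := s0; rewrite in_itv/= => /andP[a0 as'].
  have /rat_in_itvoo[c] : s < Num.min u t by rewrite lt_min su st.
  rewrite in_itv/= lt_min => /andP[sc /andP[cu ct]].
  have ac : ratr a < ratr c :> R by exact: lt_trans as' sc.
  exists (a, c) => //=; rewrite a0 ac ct/=; split; first exact: halive.
  move=> n _ /=.
  have cs : {for s, continuous (fun s => Z s w)}.
    have := cZ w (ratr a) (ratr c) a0 (halive _ sc cu).
    move=> /(continuous_within_itvP _ ac)[+ _ _]; apply.
    by rewrite in_itv/= as' sc.
  have n0 : 0 < n.+1%:R^-1 :> R by rewrite invr_gt0.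
  have /cvgrPdist_lt/(_ _ n0)/nbhs_ballP[d /= d0 hd] := cs.
  have /rat_in_itvoo[q] : s < Num.min (ratr c) (s + d) by rewrite lt_min sc ltrDl.
  rewrite in_itv/= lt_min => /andP[sq /andP[qc qd]].
  exists q => //; rewrite (ltW (lt_trans as' sq)) (ltW qc)/=.
  have := hd (ratr q); rewrite /ball/= Zs sub0r normrN; apply.
  by rewrite distrC gtr0_norm ?subr_gt0// ltrBlDl.
move=> [[a c] _] /=; case: ifP => [/andP[/andP[a0 ac] ct] [al near0]|//].
have cont := cZ w _ _ a0 al.
have := @EVT_min R (fun s => `|Z s w|) (ratr a) (ratr c) (ltW ac).
case.
  by apply/subspace_continuousP => x xac; apply: cvg_norm; exact: (subspace_continuousP _ _).1 cont x xac.
move=> s sac smin; exists s.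
move: sac; rewrite in_itv/= => /andP[as' sc].
split; [exact: lt_le_trans a0 as'|exact: le_lt_trans sc ct|].
apply/eqP; rewrite -normr_le0 leNgt; apply/negP => Zs0.
have [n _ /(_ n (leqnn n)) nZ] := near_infty_natSinv_lt (PosNum Zs0).
have [q _] := near0 n I; case: ifP => // /andP[aq qc] /= Zq.
have := smin (ratr q); rewrite in_itv/= aq qc => /(_ isT).
by rewrite leNgt (lt_trans Zq nZ).
Qed.

End HittingMeasurable.

Section RandomTime.
Context {R : realType} {d : measure_display} {Om : measurableType d}.

Lemma cvg_at_right_seq (u : nat -> R) (s : R) :
  (forall n, s < u n) -> (forall n, u n <= s + n.+1%:R^-1) -> u n @[n --> \oo] --> s^'+.
Proof.
move=> su us A [e /= e0 hA].
have [n0 _ h] := near_infty_natSinv_lt (PosNum e0).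
exists n0 => // n /= n0n; apply: hA; last exact: su.
rewrite /ball/= distrC gtr0_norm ?subr_gt0// ltrBlDl.
by rewrite (le_lt_trans (us n))// ltrD2l; exact: h.
Qed.

Lemma truncn_measurable (T : Om -> R) (k : nat) : measurable_fun setT T ->
  (forall w, 0 <= T w) -> measurable [set w | Num.truncn (T w) = k].
Proof.
move=> mT T0; rewrite (_ : [set w | _] = T @^-1` `[k%:R, k.+1%:R[).
  by rewrite -[X in measurable X]setTI; apply: mT.
apply/seteqP; split=> w /=; rewrite in_itv/=.
  by move=> <-; rewrite truncn_le ?T0// truncnS_gt.
by move=> h; apply/eqP; rewrite truncn_eq.
Qed.

(** The random time is approximated from above by times with countably many
    values. *)
Lemma random_time_measurable (Z : R -> Om -> R) (T : Om -> R) :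
  (forall s, 0 <= s -> measurable_fun setT (Z s)) ->
  (forall w s, 0 <= s -> Z u w @[u --> s^'+] --> Z s w) ->
  (forall w, 0 <= T w) -> measurable_fun setT T ->
  measurable_fun setT (fun w => Z (T w) w).
Proof.
move=> mZ rcZ T0 mT.
pose K n w := Num.truncn (n.+1%:R * T w).
apply: (@measurable_fun_cvg _ _ _ setT (fun n w => Z ((K n w).+1%:R / n.+1%:R) w)) => [n|w _].
  move=> _ B mB; rewrite setTI.
  rewrite (_ : _ @^-1` B = \bigcup_k ([set w | K n w = k] `&` Z (k.+1%:R / n.+1%:R) @^-1` B)).
    apply: bigcup_measurable => k _; apply: measurableI.
      apply: truncn_measurable; first exact: measurable_funM.
      by move=> w; rewrite mulr_ge0.
    by rewrite -[X in measurable X]setTI; apply: mZ => //; rewrite divr_ge0.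
  apply/seteqP; split=> [w /= Bw|w [k _ [/= <-]]//].
  by exists (K n w).
apply: cvg_comp (rcZ w _ (T0 w)); apply: cvg_at_right_seq => n.
  by rewrite ltr_pdivlMr// mulrC truncnS_gt.
rewrite ler_pdivrMr// mulrDl mulVf// -natr1 lerD2r mulrC truncn_le//.
by rewrite mulr_ge0.
Qed.

End RandomTime.

(** * Probabilities as real numbers and Gaussian bounds *)

Section LevelSets.
Context {R : realType} {d : measure_display} {T : measurableType d}.
Variables f g : T -> R.
Hypotheses (mf : measurable_fun setT f) (mg : measurable_fun setT g).

Lemma measurable_le_set : measurable [set x | f x <= g x].
Proof.
have := measurable_fun_ler mf mg; move=> /(_ measurableT [set true] I); rewrite setTI.
by congr measurable; apply/seteqP; split=> x /=.
Qed.

Lemma measurable_lt_set : measurable [set x | f x < g x].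
Proof.
have := measurable_fun_ltr mf mg; move=> /(_ measurableT [set true] I); rewrite setTI.
by congr measurable; apply/seteqP; split=> x /=.
Qed.

End LevelSets.

Section RealProbability.
Context {R : realType} {d : measure_display} {T : measurableType d}.
Variable Q : probability T R.
Implicit Types A B : set T.

Definition pr A : R := fine (Q A).

Lemma prE A : measurable A -> Q A = (pr A)%:E.
Proof. by move=> mA; rewrite fineK// fin_num_measure. Qed.

Lemma pr_ge0 A : 0 <= pr A.
Proof. exact: fine_ge0. Qed.

Lemma pr_le1 A : measurable A -> pr A <= 1.
Proof. by move=> mA; rewrite -lee_fin -prE// probability_le1. Qed.

Lemma pr_le A B : measurable A -> measurable B -> A `<=` B -> pr A <= pr B.
Proof. by move=> mA mB AB; rewrite -lee_fin -!prE// le_measure ?inE. Qed.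

Lemma pr_setC A : measurable A -> pr (~` A) = 1 - pr A.
Proof.
move=> mA; apply: EFin_inj; rewrite -prE; last exact: measurableC.
by rewrite probability_setC// prE.
Qed.

Lemma pr_setU A B : measurable A -> measurable B -> pr (A `|` B) <= pr A + pr B.
Proof.
move=> mA mB; rewrite -lee_fin EFinD -!prE//; last exact: measurableU.
exact: measureU2.
Qed.

Lemma pr_bigcup_lt (A : nat -> set T) (n : nat) : (forall k, measurable (A k)) ->
  pr (\bigcup_(k < n) A k) <= \sum_(k < n) pr (A k).
Proof.
move=> mA; elim: n => [|n ih].
  by rewrite bigcup_mkord big_ord0 /pr measure0 big_ord0.
rewrite bigcup_mkord !big_ord_recr/= -bigcup_mkord.
rewrite (le_trans (pr_setU _ _))// ?lerD2r//.
by apply: bigcup_measurable.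
Qed.

Lemma pr_bigcup (A : nat -> set T) (e : R) : 0 <= e -> (forall k, measurable (A k)) ->
  (forall k, pr (A k) <= e / (2 ^ k.+1)%:R) -> pr (\bigcup_k A k) <= e.
Proof.
move=> e0 mA hA; have mU : measurable (\bigcup_k A k) by exact: bigcup_measurable.
rewrite -lee_fin -prE//; apply: le_trans (epsilon_trick0 xpredT e0).
apply: (le_trans (@measure_sigma_subadditive _ _ _ Q (\bigcup_k A k) A mA mU _)) => //.
by apply: lee_nneseries => //= k _; rewrite prE// lee_fin.
Qed.

End RealProbability.

Section NormalBounds.
Context {R : realType}.
Local Notation mu := (@lebesgue_measure R).

(** On the half-line beyond [m] the centred density is dominated by the density
    centred at [m], up to the factor [exp (- m ^ 2 / 2 s ^ 2)]. *)
Lemma normal_prob_beyond (s m : R) (V : set R) : 0 < s -> measurable V ->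
  (forall x, V x -> m ^+ 2 <= m * x) ->
  (normal_prob 0 s V <= (expR (- (m ^+ 2 / (2 * s ^+ 2))))%:E)%E.
Proof.
move=> s0 mV hV; rewrite /normal_prob.
set c := expR _; have c0 : 0 <= c by exact: expR_ge0.
have sn0 : s != 0 by rewrite gt_eqF.
apply: (@le_trans _ _ (\int[mu]_(x in V) (c%:E * (normal_pdf m s x)%:E))%E).
  apply: ge0_le_integral => //.
  - by move=> x _; rewrite lee_fin normal_pdf_ge0.
  - by apply/measurable_EFinP/measurable_funTS; exact: measurable_normal_pdf.
  - by apply/measurable_EFinP/measurable_funTS; apply: measurable_funM => //; exact: measurable_normal_pdf.
  move=> x Vx; rewrite -EFinM lee_fin !normal_pdfE// /normal_fun.
  rewrite mulrCA ler_wpM2l ?normal_peak_ge0// -expRD ler_expR subr0.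
  have := hV _ Vx; rewrite -[s ^+ 2 *+ 2]mulr_natl => h.
  rewrite -[X in _ <= X + _]mulNr -mulrDl.
  by rewrite ler_wpM2r// ?invr_ge0 ?mulr_ge0 ?sqr_ge0//; move: h; rewrite !expr2; lra.
rewrite ge0_integralZl_EFin//; last 2 first.
- by move=> x _; rewrite lee_fin normal_pdf_ge0.
- by apply/measurable_EFinP/measurable_funTS; exact: measurable_normal_pdf.
rewrite -[leRHS]mule1 lee_wpmul2l ?lee_fin//.
rewrite -(integral_normal_pdf m s); apply: ge0_subset_integral => //.
- by apply/measurable_EFinP; exact: measurable_normal_pdf.
- by move=> x _; rewrite lee_fin normal_pdf_ge0.
Qed.

(** The cube of [y / 3 <= expR (y / 3)]. A third power of the squared
    deviation is what the union bound over dyadic steps needs. *)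
Lemma expRN_cube (y : R) : 0 < y -> expR (- y) <= 27 / y ^+ 3.
Proof.
move=> y0; have [z z0 ->] : exists2 z, 0 < z & y = 3%:R * z.
  by exists (y / 3); [rewrite divr_gt0|rewrite mulrCA mulfV// mulr1].
have -> : 27 / (3%:R * z) ^+ 3 = (z ^+ 3)^-1 :> R by field; rewrite gt_eqF.
rewrite expRN expRM_natl lef_pV2 ?posrE ?exprn_gt0 ?expR_gt0//.
rewrite lerXn2r ?nnegrE ?expR_ge0 ?(ltW z0)//.
by rewrite (le_trans _ (expR_ge1Dx _))// lerDr.
Qed.

Lemma normal_prob_tail (s a : R) : 0 < s -> 0 < a ->
  (normal_prob 0 s [set x : R | (a < `|x|)%R] <= (432 * s ^+ 6 / a ^+ 6)%:E)%E.
Proof.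
move=> s0 a0.
have m1 : measurable [set x : R | a < x] by apply: open_measurable; exact: open_gt.
have m2 : measurable [set x : R | x < - a] by apply: open_measurable; exact: open_lt.
have -> : [set x : R | a < `|x|] = [set x | a < x] `|` [set x | x < - a].
  apply/seteqP; split=> x /=; rewrite lter_normr.
    by rewrite ltrNr => /orP[]; [left|right].
  by move=> [->//|]; rewrite ltrNr => ->; rewrite orbT.
have h1 := @normal_prob_beyond s a _ s0 m1 ltac:(by move=> x /= ax; rewrite expr2 ler_pM2l// ltW).
have h2 := @normal_prob_beyond s (- a) _ s0 m2 ltac:(by move=> x /= ax; rewrite expr2 ler_nM2l ?oppr_lt0// ltW).
have U2 := @measureU2 _ _ _ (@normal_prob R 0 s) _ _ m1 m2.
apply: (le_trans U2).
apply: (le_trans (leeD h1 h2)); rewrite -EFinD lee_fin sqrrN.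
have y0 : 0 < a ^+ 2 / (2 * s ^+ 2) by rewrite divr_gt0 ?mulr_gt0 ?exprn_gt0.
have E := expRN_cube y0; apply: (le_trans (lerD E E)).
rewrite le_eqVlt; apply/orP; left; apply/eqP; field.
by rewrite !gt_eqF.
Qed.

(** The mass of the interval from [s] to [2 * s], or of its mirror image, is
    bounded below uniformly in the standard deviation [s]. *)
Lemma normal_prob_one_side : exists2 p : R, 0 < p & forall (b : bool) (s : R), 0 < s ->
  (p%:E <= normal_prob 0 s [set x : R | (s < (-1) ^+ b * x)%R])%E.
Proof.
exists ((Num.sqrt (pi *+ 2))^-1 * expR (- 2)).
  by rewrite mulr_gt0 ?expR_gt0// invr_gt0 sqrtr_gt0 mulrn_wgt0// pi_gt0.
move=> b s s0; have sn0 : s != 0 by rewrite gt_eqF.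
pose V : set R := if b then `]- (2 * s), - s[%classic else `]s, 2 * s[%classic.
have mV : measurable V by rewrite /V; case: (b).
have muV : mu V = s%:E.
  rewrite /V; case: (b); rewrite lebesgue_measure_itv/= lte_fin.
    rewrite ltrN2 ltr_pMl// ltr1n -EFinD opprK; congr EFin; ring.
  by rewrite ltr_pMl// ltr1n -EFinD; congr EFin; ring.
have mW : measurable [set x : R | (s < (-1) ^+ b * x)%R].
  rewrite (_ : [set x : R | _] = if b then `]-oo, - s[%classic else `]s, +oo[%classic).
    by case: (b).
  apply/seteqP; case: (b); split=> x /=; rewrite in_itv/= ?andbT ?expr1 ?expr0 ?mulN1r ?mul1r//; lra.
apply: (@le_trans _ _ (\int[mu]_(x in V) ((normal_peak s * expR (- 2))%:E))%E).
  rewrite integral_cst//; apply: (@le_trans _ _ ((normal_peak s * expR (- 2))%:E * mu V)%E) => //.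
  rewrite muV -EFinM lee_fin /normal_peak.
  rewrite -mulrnAr sqrtrM ?sqr_ge0// sqrtr_sqr gtr0_norm// invfM.
  move: (Num.sqrt (pi *+ 2))^-1 (expR (- 2)) => q e.
  by rewrite (_ : s^-1 * q * e * s = q * e)//; field.
apply: (@le_trans _ _ (normal_prob 0 s V)).
  rewrite /normal_prob; apply: ge0_le_integral => //.
  - by move=> x _; rewrite lee_fin mulr_ge0 ?normal_peak_ge0 ?expR_ge0.
  - by apply/measurable_EFinP/measurable_funTS; exact: measurable_normal_pdf.
  move=> x Vx; rewrite lee_fin normal_pdfE// /normal_fun ler_wpM2l ?normal_peak_ge0//.
  rewrite ler_expR subr0 -[s ^+ 2 *+ 2]mulr_natl mulNr lerN2 ler_pdivrMr ?mulr_gt0 ?exprn_gt0//.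
  rewrite mulrA -natrM (_ : (2 * 2)%:R * s ^+ 2 = (2 * s) ^+ 2); last by rewrite exprMn -natrX.
  rewrite -ler_sqrt ?sqr_ge0// !sqrtr_sqr (gtr0_norm (_ : 0 < 2 * s)) ?mulr_gt0//.
  by move: Vx; rewrite /V; case: (b); rewrite /= in_itv/= ler_norml; lra.
apply: ge0_subset_integral => //.
- by apply/measurable_EFinP/measurable_funTS; exact: measurable_normal_pdf.
- by move=> x _; rewrite lee_fin normal_pdf_ge0.
- by move=> x; rewrite /V; case: (b); rewrite /= in_itv/= ?expr1 ?expr0; lra.
Qed.

End NormalBounds.

(** * Oscillation of Brownian paths *)

Lemma measurable_abs_gt (R : realType) (a : R) : measurable [set y : R | a < `|y|].
Proof.
apply: open_measurable; apply: (@open_comp _ _ (fun y : R => `|y|) [set z | a < z]) => [y _|].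
  exact: norm_continuous.
exact: open_gt.
Qed.

(** The value at [e] of the constant produced by chaining: twice the constant of
    the Gaussian tail, for deviations of size [e / 10]. *)
Definition oscillation_const (R : realType) (e : R) : R := 864 / (e / 10) ^+ 6.

Lemma oscillation_const_ge0 (R : realType) (e : R) : 0 < e -> 0 <= oscillation_const e.
Proof.
by move=> e0; apply: divr_ge0; [exact: ler0n|apply/exprn_ge0/ltW; rewrite divr_gt0].
Qed.

Lemma oscillation_const_small (R : realType) (K e : R) : 0 <= K -> 0 < e ->
  exists2 a, 0 < a & K * oscillation_const a < e.
Proof.
move=> K0 e0; have [C C0 CE] : exists2 C : R, 0 <= C & oscillation_const 1 = C.
  by exists (oscillation_const 1); [exact: oscillation_const_ge0|reflexivity].
pose a := K * C / e + 1.
have q0 : 0 <= K * C / e by apply: divr_ge0; [exact: mulr_ge0|exact: ltW].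
have a1 : 1 <= a by rewrite lerDr.
have a0 : 0 < a by exact: lt_le_trans a1.
exists a => //.
have -> : oscillation_const a = C / a ^+ 6.
  by rewrite -CE /oscillation_const; field; rewrite gt_eqF.
rewrite mulrA ltr_pdivrMr ?exprn_gt0//.
have aa : a <= a ^+ 6 by rewrite exprS ler_peMr ?(ltW a0)// exprn_ege1.
apply: (lt_le_trans _ (ler_wpM2l (ltW e0) aa)).
by rewrite [ltRHS]mulrC -ltr_pdivrMr// /a ltrDl.
Qed.

Section BrownianPaths.
Context {R : realType} {d : measure_display} {Om : measurableType d}.
Variables (Q : probability Om R) (W : R -> Om -> R) (x : R).
Hypothesis bmW : standard_brownian Q W x.

Lemma bm_incr_measurable (s t : R) : 0 <= s -> 0 <= t ->
  measurable_fun setT (fun w => W t w - W s w).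
Proof. by move=> s0 t0; apply: measurable_funB; exact: (sb_measurable bmW). Qed.

Lemma bm_path_continuous (w : Om) (s e : R) : 0 <= s -> 0 < e ->
  exists2 eta, 0 < eta & forall u, 0 <= u -> `|u - s| < eta -> `|W u w - W s w| < e.
Proof.
move=> s0 e0; have s0' : s \in `[0, +oo[ by rewrite in_itv/= s0.
have /subspace_continuousP/(_ s s0') := @sb_continuous _ _ _ Q W x bmW w.
move=> /cvgrPdist_lt/(_ e e0)/nbhs_ballP[eta /= eta0 h].
exists eta => // u u0 us; rewrite distrC; apply: h; first by rewrite /ball/= distrC.
by rewrite /= in_itv/= u0.
Qed.

Definition big_increment (s t a : R) : set Om := [set w | a < `|W t w - W s w|].

Lemma big_increment_measurable (s t a : R) : 0 <= s -> 0 <= t ->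
  measurable (big_increment s t a).
Proof.
move=> s0 t0; rewrite -[X in measurable X]setTI.
exact: (bm_incr_measurable s0 t0 measurableT (measurable_abs_gt a)).
Qed.

Lemma pr_big_increment (s t a : R) : 0 <= s -> s < t -> 0 < a ->
  pr Q (big_increment s t a) <= 432 * (t - s) ^+ 3 / a ^+ 6.
Proof.
move=> s0 st a0; have t0 : 0 <= t by rewrite ltW// (le_lt_trans s0).
rewrite -lee_fin -prE; last exact: big_increment_measurable.
rewrite /big_increment (sb_gaussian bmW s0 st (measurable_abs_gt a)).
have s0' : 0 < Num.sqrt (t - s) by rewrite sqrtr_gt0 subr_gt0.
rewrite (le_trans (normal_prob_tail s0' a0))// lee_fin.
by rewrite (_ : Num.sqrt (t - s) ^+ 6 = (t - s) ^+ 3)// (exprM _ 2 3) sqr_sqrtr// subr_ge0 ltW.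
Qed.

Lemma geometric_partial_sum (n : nat) :
  \sum_(j < n) (9 / 10) ^+ j / 10 <= 1 :> R.
Proof.
have -> : \sum_(j < n) (9 / 10) ^+ j / 10 = 1 - (9 / 10) ^+ n :> R.
  elim: n => [|n ih]; first by rewrite big_ord0 expr0 subrr.
  by rewrite big_ord_recr/= ih exprS; field.
by rewrite gerBl exprn_ge0// divr_ge0.
Qed.

(** Chaining over the dyadic subdivisions of [[0, t]]: if for every [n] the
    increments over the steps of length [t / 2 ^ n] are at most
    [e * (9 / 10) ^ n / 10], the sum of these bounds controls the path at all
    dyadic times. Only the union bound and the sixth-order tail of a Gaussian
    are used. *)
Lemma bm_small_oscillation (t e : R) : 0 < t -> 0 < e ->
  exists Bad : set Om, [/\ measurable Bad,
    pr Q Bad <= oscillation_const e * t ^+ 3 &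
    forall w, ~ Bad w -> forall s, 0 <= s -> s <= t -> `|W s w - W 0 w| <= e].
Proof.
move=> t0 e0; pose dy (n k : nat) : R := t * k%:R / (2 ^ n)%:R.
pose c (n : nat) : R := e * ((9 / 10) ^+ n / 10).
have p2 (n : nat) : 0 < (2 ^ n)%:R :> R by rewrite ltr0n expn_gt0.
have dy0 n k : 0 <= dy n k by rewrite /dy divr_ge0 ?mulr_ge0 ?ler0n// ltW.
have c0 n : 0 < c n by rewrite /c mulr_gt0// divr_gt0// exprn_gt0// divr_gt0.
have dyS n k : dy n k.+1 - dy n k = t / (2 ^ n)%:R.
  by rewrite /dy -mulrBl -mulrBr -natrB// subSnn mulr1.
have dylt n k : dy n k < dy n k.+1 by rewrite -subr_gt0 dyS divr_gt0.
pose step n k := big_increment (dy n k) (dy n k.+1) (c n).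
pose level n := \bigcup_(k < 2 ^ n) step n k.
have mstep n k : measurable (step n k) by apply: big_increment_measurable.
have mlevel n : measurable (level n) by apply: bigcup_measurable.
exists (\bigcup_n level n); split; first exact: bigcup_measurable.
  have bound0 : 0 <= oscillation_const e * t ^+ 3.
    by apply: mulr_ge0; [exact: oscillation_const_ge0|exact/exprn_ge0/ltW].
  apply: pr_bigcup => [|//|n]; first exact: bound0.
  apply: (le_trans (pr_bigcup_lt Q _ (mstep n))).
  apply: (@le_trans _ _ (\sum_(k < 2 ^ n) 432 * (t / (2 ^ n)%:R) ^+ 3 / c n ^+ 6)).
    by apply: ler_sum => k _; rewrite -(dyS n k); exact: pr_big_increment.
  rewrite sumr_const card_ord -[X in X <= _]mulr_natl /c.
  have -> : (2 ^ n)%:R = 2 ^+ n :> R by rewrite natrX.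
  have -> : (2 ^ n.+1)%:R = 2 * 2 ^+ n :> R by rewrite natrX exprS.
  (* the ratio 9/10 is close enough to one for the level bounds to decrease like
     [2 ^ - n] *)
  have : 1 <= (2%:R * (9 / 10) ^+ 6) ^+ n :> R by rewrite exprn_ege1//; lra.
  rewrite exprMn -exprM mulnC exprM.
  have : 0 < (9 / 10) ^+ n :> R by rewrite exprn_gt0// divr_gt0.
  have : 0 < 2 ^+ n :> R by rewrite exprn_gt0.
  move: (2 ^+ n) ((9 / 10) ^+ n) => u v u0 v0 uv.
  have -> : u * (432 * (t / u) ^+ 3 / (e * (v / 10)) ^+ 6) =
     (oscillation_const e * t ^+ 3 / (2 * u)) / (u * v ^+ 6).
    by rewrite /oscillation_const; field; rewrite !gt_eqF.
  move: bound0; move: (oscillation_const e * _) => K K0.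
  have Ku : 0 <= K / (2 * u) by rewrite divr_ge0// mulr_ge0// ltW.
  by rewrite ler_pdivrMr ?(lt_le_trans ltr01)// ler_peMr.
move=> w nB.
have small n k : (k < 2 ^ n)%N -> `|W (dy n k.+1) w - W (dy n k) w| <= c n.
  move=> kn; rewrite leNgt; apply/negP => h; apply: nB.
  by exists n => //; exists k.
have dyadic n k : (k <= 2 ^ n)%N -> `|W (dy n k) w - W 0 w| <= \sum_(j < n.+1) c j.
  elim: n k => [|n ih] k kn.
    rewrite big_ord1; case: k kn => [|[|//]] kn.
      by rewrite /dy mulr0 mul0r subrr normr0 ltW.
    have := small 0%N 0%N isT; rewrite [dy 0%N 0%N](_ : _ = 0)//.
    by rewrite /dy mulr0 mul0r.
  have dyE m : dy n.+1 m.*2 = dy n m.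
    rewrite /dy -muln2 natrM expnS natrM; field.
    by rewrite gt_eqF.
  have kh : (k./2 <= 2 ^ n)%N.
    rewrite -leq_double -[X in (_ <= X)%N]mul2n -expnS (leq_trans _ kn)//.
    by rewrite -[X in (_ <= X)%N]odd_double_half leq_addl.
  rewrite big_ord_recr/= -(odd_double_half k); case ok: (odd k); rewrite ?add0n ?add1n.
    rewrite addrC -(subrKA (W (dy n.+1 (k./2).*2) w)).
    rewrite (le_trans (ler_normD _ _))// lerD//; last by rewrite dyE ih.
    apply: small; rewrite -[(_ < _)%N]/((k./2).*2.+1 <= _)%N.
    by move: kn; rewrite -{1}(odd_double_half k) ok.
  by rewrite dyE (le_trans (ih _ kh))// lerDl ltW.
have total n : \sum_(j < n) c j <= e.
  rewrite -mulr_sumr -[leRHS]mulr1 ler_wpM2l ?(ltW e0)//; exact: geometric_partial_sum.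
move=> s s0 st; rewrite leNgt; apply/negP => he.
have [eta eta0 heta] := @bm_path_continuous w s (`|W s w - W 0 w| - e) s0 ltac:(by rewrite subr_gt0).
(* a dyadic time so close to [s] that continuity contradicts the dyadic bound *)
have [n hn] : exists n : nat, t / (2 ^ n)%:R < eta.
  exists (Num.truncn (t / eta)).+1; rewrite ltr_pdivrMr// mulrC -ltr_pdivrMr//.
  rewrite (lt_le_trans (truncnS_gt _))// ler_nat ltnW// ltn_expl//.
pose k := Num.truncn (s / (t / (2 ^ n)%:R)).
have h0 : 0 < t / (2 ^ n)%:R by rewrite divr_gt0.
have /andP[k1 k2] : k%:R <= s / (t / (2 ^ n)%:R) < k.+1%:R.
  by rewrite truncn_itv// divr_ge0// ltW.
have kn : (k <= 2 ^ n)%N.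
  rewrite -(ler_nat R) (le_trans k1)// ler_pdivrMr// mulrC divfK ?gt_eqF//.
have dyk : dy n k = k%:R * (t / (2 ^ n)%:R) by rewrite /dy mulrAC mulrC.
have close : `|dy n k - s| < eta.
  rewrite dyk distrC ger0_norm ?subr_ge0 -?ler_pdivlMr//.
  rewrite (lt_trans _ hn)// ltrBlDl.
  move: k2; rewrite ltr_pdivrMr// -natr1 mulrDl mul1r; lra.
have := heta _ (dy0 n k) close.
have := le_trans (dyadic n k kn) (total _).
have := ler_normB (W (dy n k) w - W 0 w) (W (dy n k) w - W s w).
rewrite opprB addrC subrKA => h1 h2 h3.
by have := le_trans h1 (lerD h2 (ltW h3)); lra.
Qed.

End BrownianPaths.

(** * Brownian paths cross their starting point at once *)

Section Crossing.
Context {R : realType}.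

Lemma exists_small_power (p e : R) : 0 < p -> p <= 1 -> 0 < e ->
  exists n : nat, (1 - p) ^+ n <= e.
Proof.
move=> p0 p1 e0.
have : (fun n => (1 - p) ^+ n) @ \oo --> (0 : R).
  by apply: cvg_expr; rewrite ger0_norm ?subr_ge0// gtrBl.
move=> /cvgrPdist_le/(_ e e0)[n _ h]; exists n.
have := h n (leqnn n); rewrite /= sub0r normrN ger0_norm// exprn_ge0// subr_ge0//.
Qed.

(** A Brownian path immediately visits both sides of its starting point. Along
    times growing geometrically with a large ratio, each increment exceeds its
    standard deviation with probability at least [p], independently, while the
    position at its beginning is with high probability negligible. The times
    and the level depend neither on the path space nor on the starting point,
    which makes the estimate uniform. *)
Lemma bm_crosses_soon (b : bool) (T e : R) : 0 < T -> 0 < e ->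
  exists (N : nat) (tt : nat -> R) (eta : R),
  [/\ 0 < eta, (forall i, 0 < tt i), (forall i, tt i <= T) &
  forall (d : measure_display) (Om : measurableType d) (Q : probability Om R)
    (W : R -> Om -> R) (x : R), standard_brownian Q W x ->
    exists Bad : set Om, [/\ measurable Bad, pr Q Bad <= e &
      forall w, ~ Bad w -> exists2 k, (k < N)%N &
        eta < (-1) ^+ b * (W (tt k.+1) w - W 0 w)]].
Proof.
move=> T0 e0; have e20 : 0 < e / 2 by rewrite divr_gt0.
have [p0 p00 hp0] := @normal_prob_one_side R.
pose p := Num.min p0 1; have p_gt0 : 0 < p by rewrite lt_min p00 ltr01.
have p1 : p <= 1 by rewrite ge_min lexx orbT.
have [N hN] := exists_small_power p_gt0 p1 e20.
(* 432 from the Gaussian tail, and 64 since the deviation allowed at the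
   beginning of an increment is half of its standard deviation *)
have [C C0 CE] : exists2 C : R, 0 < C & C = 432 * 64 by exists (432 * 64); [lra|reflexivity].
pose K : R := C * N.+1%:R.
have K0 : 0 < K by rewrite mulr_gt0// ltr0n.
pose c := Num.min 1 (e / 2 / K).
have c0 : 0 < c by rewrite lt_min ltr01 divr_gt0.
have c1 : c <= 1 by rewrite ge_min lexx.
have cK : K * c ^+ 3 <= e / 2.
  have cc : c ^+ 3 <= c by rewrite exprS ler_piMr ?exprn_ile1// ltW.
  rewrite (le_trans (ler_wpM2l (ltW K0) cc))//.
  by rewrite mulrC -ler_pdivlMr// ge_min lexx orbT.
pose r : R := (1 + c) / c.
have r0 : 0 < r by rewrite divr_gt0// addr_gt0.
have r1 : 1 <= r by rewrite ler_pdivlMr// mul1r lerDr.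
(* truncated subtraction: the times stay equal to [T] from index [N] on *)
pose tt (i : nat) : R := T / r ^+ (N - i).
have tt0 i : 0 < tt i by rewrite divr_gt0// exprn_gt0.
have ttS i : (i < N)%N -> tt i.+1 = tt i * r.
  move=> iN; rewrite /tt subnS -{2}(prednK (_ : 0 < N - i)%N) ?subn_gt0//.
  by rewrite exprS; field; rewrite !gt_eqF// exprn_gt0.
have ttD i : (i < N)%N -> tt i.+1 - tt i = tt i / c.
  by move=> iN; rewrite ttS// /r; field; rewrite gt_eqF.
have ttle i : tt i <= tt i.+1.
  have [iN|Ni] := ltnP i N; first by rewrite ttS// ler_peMr// ltW.
  have [e1 e2] : (N - i = 0 /\ N - i.+1 = 0)%N.
    by split; apply/eqP; rewrite subn_eq0 // leqW.
  by rewrite /tt e1 e2.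
have tt_mono i : tt 0%N <= tt i by elim: i => // i ih; exact: le_trans ih (ttle i).
pose sd i := Num.sqrt (tt i / c).
have sd0 i : 0 < sd i by rewrite sqrtr_gt0 divr_gt0.
exists N, tt, (sd 0%N / 2); split=> //.
- by rewrite divr_gt0.
- move=> i; rewrite ler_pdivrMr ?exprn_gt0//.
  by apply: ler_peMr; [exact: ltW|exact: exprn_ege1].
move=> d Om Q W x bmW.
pose s : R := (-1) ^+ b.
pose far k := big_increment W 0 (tt k) (sd k / 2).
pose noinc := [set w | forall i, (i < N)%N -> [set y : R | s * y <= sd i] (W (tt i.+1) w - W (tt i) w)].
have mhalf i : measurable [set y : R | s * y <= sd i].
  by apply: measurable_le_set => //; exact: measurable_funM.
have mnoinc : measurable noinc.
  rewrite (_ : noinc = \bigcap_(i < N) ((fun w => W (tt i.+1) w - W (tt i) w) @^-1` [set y : R | s * y <= sd i])).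
    apply: bigcap_measurableType => i _; rewrite -[X in measurable X]setTI.
    exact: (bm_incr_measurable bmW (ltW (tt0 _)) (ltW (tt0 _)) measurableT (mhalf i)).
  by apply/seteqP; split=> w h i; exact: h.
have mfar k : measurable (far k).
  by apply: (big_increment_measurable bmW) => //; exact: ltW.
have mfars : measurable (\bigcup_(k < N) far k) by exact: bigcup_measurable.
exists (noinc `|` \bigcup_(k < N) far k); split.
- exact: measurableU.
- apply: (le_trans (pr_setU _ mnoinc mfars)); rewrite [leRHS]splitr; apply: lerD.
    apply: le_trans hN; rewrite -lee_fin -prE//.
    have ind := @sb_independent _ _ _ _ _ _ bmW N tt (fun i => [set y : R | s * y <= sd i])
      (ltW (tt0 0%N)) ttle mhalf.
    rewrite [Q noinc]ind.
    have mD k : measurable_fun setT (fun w => W (tt k.+1) w - W (tt k) w).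
      by apply: (bm_incr_measurable bmW); exact: ltW.
    have minc k : measurable [set w | s * (W (tt k.+1) w - W (tt k) w) <= sd k].
      by apply: measurable_le_set => //; exact: measurable_funM.
    rewrite (eq_bigr (fun k : 'I_N => (pr Q [set w | s * (W (tt k.+1) w - W (tt k) w) <= sd k])%:E)); last first.
      by move=> k _; exact: prE (minc k).
    rewrite prodEFin lee_fin -[in leRHS](card_ord N) -prodr_const; apply: ler_prod => k _.
    rewrite pr_ge0/= lerBrDr -lerBrDl -pr_setC//.
    have tlt : tt k < tt k.+1 by rewrite -subr_gt0 ttD// divr_gt0.
    have mV : measurable [set y : R | sd k < s * y].
      by apply: measurable_lt_set => //; exact: measurable_funM.
    have := sb_gaussian bmW (ltW (tt0 k)) tlt mV; rewrite ttD// => gau.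
    have minc' : measurable [set w | sd k < s * (W (tt k.+1) w - W (tt k) w)].
      by apply: measurable_lt_set => //; exact: measurable_funM.
    have -> : ~` [set w | s * (W (tt k.+1) w - W (tt k) w) <= sd k] =
        [set w | sd k < s * (W (tt k.+1) w - W (tt k) w)].
      by apply/seteqP; split=> w /=; [move=> /negP; rewrite -ltNge|rewrite ltNge => /negP].
    have ple : p <= p0 by rewrite ge_min lexx.
    by rewrite (le_trans ple)// -lee_fin -prE// [leRHS]gau; apply: hp0; exact: sd0.
  apply: (le_trans (pr_bigcup_lt Q N mfar)).
  apply: (@le_trans _ _ (\sum_(k < N) C * c ^+ 3)).
    apply: ler_sum => k _.
    have := @pr_big_increment _ _ _ Q W x bmW 0 (tt k) (sd k / 2) (lexx 0) (tt0 k) ltac:(by rewrite divr_gt0).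
    move=> /le_trans; apply; rewrite subr0.
    have -> : (sd k / 2) ^+ 6 = (tt k / c) ^+ 3 / 64.
      rewrite expr_div_n [sd k ^+ 6](exprM _ 2 3) sqr_sqrtr; last by rewrite ltW// divr_gt0.
      by congr (_ / _); rewrite -natrX.
    rewrite CE le_eqVlt; apply/orP; left; apply/eqP; field.
    by rewrite !gt_eqF.
  rewrite sumr_const card_ord -[X in X <= _]mulr_natl; apply: le_trans cK.
  rewrite mulrA ler_wpM2r ?exprn_ge0 ?(ltW c0)// mulrC ler_wpM2l ?(ltW C0)// ler_nat.
  exact: leqnSn.
move=> w /not_orP[nn nf].
have [k [kN hk]] : exists k, (k < N)%N /\ sd k < s * (W (tt k.+1) w - W (tt k) w).
  apply/not_existsP => h; apply: nn => i iN /=.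
  by rewrite leNgt; apply/negP => hi; apply: (h i).
exists k => //.
have : `|W (tt k) w - W 0 w| <= sd k / 2.
  by rewrite leNgt; apply/negP => hi; apply: nf; exists k.
have sdm : sd 0%N <= sd k by rewrite ler_wsqrtr// ler_pM2r ?invr_gt0.
move: hk sdm; rewrite /s; case: (b) => /=; rewrite ?expr1 ?expr0 ler_norml.
  by move=> ? ? /andP[? ?]; lra.
by move=> ? ? /andP[? ?]; lra.
Qed.

End Crossing.

(** * Integrals of bounded functions *)

Section BoundedIntegrals.
Context {R : realType} {d : measure_display} {T : measurableType d}.
Variable Q : probability T R.
Implicit Types (D : set T) (g : T -> R).

Lemma bounded_integrable D g (M : R) : measurable D -> measurable_fun setT g ->
  (forall x, `|g x| <= M) -> Q.-integrable D (EFin \o g).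
Proof.
move=> mD mg gM; apply: measurable_bounded_integrable => //.
- by rewrite (le_lt_trans (probability_le1 Q mD))// ltry.
- exact: measurable_funTS.
- by exists M; split; [exact: num_real|move=> y /ltW My x _; exact: le_trans (gM x) My].
Qed.

Lemma Rintegral_norm_le D g (k : R) : measurable D -> Q.-integrable D (EFin \o g) ->
  (forall x, D x -> `|g x| <= k) -> `|\int[Q]_(x in D) g x| <= k * pr Q D.
Proof.
move=> mD ig gk; apply: (le_trans (le_normr_Rintegral mD ig)).
rewrite -(Rintegral_cst Q mD k); apply: le_Rintegral => //.
  by have := integrable_abse ig; apply: eq_integrable.
apply: measurable_bounded_integrable => //; first by rewrite (le_lt_trans (probability_le1 Q mD))// ltry.
by exists `|k|; split; [exact: num_real|move=> y ky x _ /=; exact: ltW].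
Qed.

Lemma Rintegral_setC_split D g : measurable D -> Q.-integrable setT (EFin \o g) ->
  \int[Q]_x g x = \int[Q]_(x in D) g x + \int[Q]_(x in ~` D) g x.
Proof.
move=> mD ig; rewrite -Rintegral_setU//; first by rewrite setUv.
- exact: measurableC.
- by rewrite setUv.
- by apply/disj_setPS => x [].
Qed.

Lemma Rintegral_indic D g : measurable D ->
  \int[Q]_x (\1_D x * g x) = \int[Q]_(x in D) g x.
Proof.
move=> mD; rewrite [RHS]Rintegral_mkcond; apply: eq_Rintegral => x _.
by rewrite /patch indicE; case: ifP; rewrite ?mul1r ?mul0r.
Qed.

(** A sum over finitely many disjoint pieces inherits a bound that holds for the
    integral over each piece in proportion to its probability. *)
Lemma Rintegral_pieces_le (N : nat) (A : nat -> set T) (g : nat -> T -> R) (k : R) :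
  0 <= k -> (forall i, measurable (A i)) -> trivIset setT A ->
  (forall i, Q.-integrable setT (EFin \o g i)) ->
  (forall i, `|\int[Q]_(x in A i) g i x| <= k * pr Q (A i)) ->
  Q.-integrable setT (EFin \o (fun x => \sum_(i < N) \1_(A i) x * g i x)) /\
  `|\int[Q]_x (\sum_(i < N) \1_(A i) x * g i x)| <= k.
Proof.
move=> k0 mA tA ig gk.
have iAg i : Q.-integrable setT (EFin \o (fun x => \1_(A i) x * g i x)).
  have := integrableS measurableT (mA i) (@subsetT _ _) (ig i).
  rewrite integrable_mkcond//; apply: eq_integrable => // x _.
  by rewrite /patch /= indicE; case: ifP; rewrite ?mul1r ?mul0r.
have key n : Q.-integrable setT (EFin \o (fun x => \sum_(i < n) \1_(A i) x * g i x)) /\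
    `|\int[Q]_x (\sum_(i < n) \1_(A i) x * g i x)| <= k * \sum_(i < n) pr Q (A i).
  elim: n => [|n [ih1 ih2]].
    have e0 : (fun x => \sum_(i < 0) \1_(A i) x * g i x) = cst 0.
      by apply/funext => x; rewrite big_ord0.
    by rewrite e0 big_ord0 mulr0 Rintegral_cst// mul0r normr0; split=> //; exact: integrable0.
  have eS : (fun x => \sum_(i < n.+1) \1_(A i) x * g i x) =
      (fun x => (\sum_(i < n) \1_(A i) x * g i x) + \1_(A n) x * g n x).
    by apply/funext => x; rewrite big_ord_recr.
  rewrite eS; split; first by have := integrableD measurableT ih1 (iAg n); apply: eq_integrable.
  rewrite RintegralD// (le_trans (ler_normD _ _))// big_ord_recr/= mulrDr lerD//.
  by rewrite Rintegral_indic.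
split; first exact: (key N).1.
apply: (le_trans (key N).2); rewrite -[leRHS]mulr1 ler_wpM2l//.
rewrite -lee_fin -sumEFin (eq_bigr (fun i : 'I_N => Q (A i))) => [|i _]; last by rewrite prE.
rewrite -measure_bigsetU//.
by apply: probability_le1; apply: bigsetU_measurable.
Qed.

Lemma bounded_convergence D (g_ : nat -> T -> R) g (M : R) : measurable D ->
  (forall n, measurable_fun setT (g_ n)) -> (forall n x, `|g_ n x| <= M) ->
  measurable_fun setT g ->
  (forall x, D x -> g_ n x @[n --> \oo] --> g x) ->
  \int[Q]_(x in D) g_ n x @[n --> \oo] --> \int[Q]_(x in D) g x.
Proof.
move=> mD mg_ gM mg cvg.
have iM : Q.-integrable D (EFin \o cst M).
  by apply: (@bounded_integrable _ _ `|M|) => // x; exact: lexx.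
have [] := @dominated_convergence _ T R Q D mD (fun n => EFin \o g_ n) (EFin \o g)
  (EFin \o cst M).
- by move=> n; apply/measurable_EFinP; exact: measurable_funTS.
- by apply/measurable_EFinP; exact: measurable_funTS.
- by apply: aeW => x Dx; apply: cvg_EFin; [exact: nearW|exact: cvg].
- exact: iM.
- by apply: aeW => x n _; rewrite lee_fin; exact: gM.
move=> ig _ h; apply: fine_cvg; rewrite fineK//; exact: integrable_fin_num.
Qed.

End BoundedIntegrals.

(** * Paths and hitting times on the graph *)

Section HittingTimes.
Context {R : realType} {d : measure_display} {Om : measurableType d}.

Lemma hitting_time_ge0 (E : Type) (Z : R -> Om -> E) (A : set E) (w : Om) :
  (0 <= hitting_time Z A w)%E.
Proof. by apply: le_ereal_inf_tmp => _ [t [t0 _] <-]; rewrite lee_fin ltW. Qed.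

Lemma hitting_time_lt (E : Type) (Z : R -> Om -> E) (A : set E) (w : Om) (t : R) :
  (hitting_time Z A w < t%:E)%E <-> exists s, [/\ 0 < s, s < t & A (Z s w)].
Proof.
split=> [/ereal_inf_lt[_ [s [s0 As] <-]]|[s [s0 st As]]].
  by rewrite lte_fin => st; exists s.
apply: (@le_lt_trans _ _ s%:E); last by rewrite lte_fin.
by apply: ereal_inf_lbound; exists s.
Qed.

Lemma hitting_time_le (E : Type) (Z : R -> Om -> E) (A : set E) (w : Om) (s : R) :
  0 < s -> A (Z s w) -> (hitting_time Z A w <= s%:E)%E.
Proof. by move=> s0 As; apply: ereal_inf_lbound; exists s. Qed.

(** A right-continuous path is in a closed set, here a zero set, when it hits it. *)
Lemma hitting_time_zero (Z : R -> Om -> R) (w : Om) (s : R) : 0 <= s ->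
  Z u w @[u --> s^'+] --> Z s w ->
  hitting_time Z [set 0] w = s%:E -> Z s w = 0.
Proof.
move=> s0 rc hs; apply/eqP; rewrite -normr_le0 leNgt; apply/negP => Zs.
have /cvgrPdist_lt/(_ _ Zs)[e /= e0 he] := rc.
have [|u [u0 use Zu]] := (hitting_time_lt Z [set 0] w (s + e)).1.
  by rewrite hs lte_fin ltrDl.
have su : s <= u.
  by rewrite -lee_fin -hs; exact: hitting_time_le.
move: su; rewrite le_eqVlt => /orP[/eqP su|su].
  by move: Zs; rewrite su Zu normr0 ltxx.
have := he u; rewrite /ball/= distrC gtr0_norm ?subr_gt0// ltrBlDl => /(_ use su).
by rewrite Zu subr0 ltxx.
Qed.

End HittingTimes.

Section Paths.
Context {R : realType} {G : metric_graph R}.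
Context {d : measure_display} {Om : measurableType d}.
Variables (P : gpoint G -> probability Om R) (F : R -> set (set Om)).
Variables (X : R -> Om -> cemetery (gpoint G)) (theta : R -> Om -> Om).
Hypothesis bm : brownian_motion P F X theta.

Definition alive_ind : cemetery (gpoint G) -> R := extc 0 (cst 1).

Lemma alive_ind_continuous : continuous alive_ind.
Proof. by apply: extc_continuous; exact: cst_continuous. Qed.

Lemma alive_indP (p : cemetery (gpoint G)) : p <> None <-> alive_ind p <> 0.
Proof. by case: p => [p|]; split=> // _; apply/eqP; exact: oner_neq0. Qed.

Lemma alive_right (c : R) (w : Om) : 0 <= c -> X c w <> None ->
  exists2 u, c < u & forall s, c <= s -> s < u -> X s w <> None.
Proof.
move=> c0 Xc.
have : alive_ind (X s w) @[s --> c^'+] --> alive_ind (X c w).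
  have rc := @bm_right_continuous _ _ _ _ _ _ _ _ bm w c c0.
  exact: (cvg_comp _ _ rc (@alive_ind_continuous (X c w))).
move=> /cvgrPdist_lt/(_ 1 ltr01)[e /= e0 he].
exists (c + e); first by rewrite ltrDl.
move=> s; rewrite le_eqVlt => /orP[/eqP <-//|cs] se.
have := he s; rewrite /ball/= distrC gtr0_norm ?subr_gt0// ltrBlDl => /(_ se cs).
have -> : alive_ind (X c w) = 1 by case: (X c w) Xc.
by case: (X s w) => //=; rewrite subr0 normr1 ltxx.
Qed.

Lemma alive_lt_lifetime (c : R) (w : Om) : 0 <= c -> X c w <> None ->
  (c%:E < lifetime X w)%E.
Proof.
move=> c0 Xc; have [u cu hu] := alive_right c0 Xc.
apply: (@lt_le_trans _ _ u%:E); first by rewrite lte_fin.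
apply: le_ereal_inf_tmp => _ [t [t0 Xt] <-]; rewrite lee_fin leNgt; apply/negP => tu.
have [ct|tc] := leP c t; first exact: (hu t).
exact: Xc (bm_absorbing bm t0 (ltW tc) Xt).
Qed.

Variable phi : cemetery (gpoint G) -> R.
Hypothesis phic : continuous phi.

Lemma path_right_continuous (w : Om) (s : R) : 0 <= s ->
  phi (X u w) @[u --> s^'+] --> phi (X s w).
Proof.
move=> s0; have rc := @bm_right_continuous _ _ _ _ _ _ _ _ bm w s s0.
exact: (cvg_comp _ _ rc (@phic (X s w))).
Qed.

Lemma path_continuous_alive (w : Om) (a c : R) : 0 <= a -> X c w <> None ->
  {within `[a, c], continuous (fun s => phi (X s w))}.
Proof.
move=> a0 Xc; have [c0|c0] := leP 0 c; last first.
  rewrite (_ : [set` `[a, c]] = set0); first by apply: continuous_subspace0.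
  by rewrite set_itv_ge// bnd_simp -ltNge (lt_le_trans c0).
have sub : [set` `[a, c]] `<=` [set t : R | 0 <= t /\ (t%:E < lifetime X w)%E].
  move=> t; rewrite /= in_itv/= => /andP[at' tc]; split; first exact: le_trans a0 at'.
  by rewrite (le_lt_trans _ (alive_lt_lifetime c0 Xc))// lee_fin.
have Xcont := continuous_subspaceW sub (@bm_continuous _ _ _ _ _ _ _ _ bm w).
by move=> t; apply: continuous_comp; [exact: Xcont|exact: phic].
Qed.

Lemma path_measurable_wrt (s : R) : 0 <= s -> measurable_wrt (F s) measurable (phi \o X s).
Proof.
move=> s0; apply: comp_measurable_wrt (bm_adapted bm s0) _; exact: continuous_borel.
Qed.

Lemma path_measurable (s : R) : 0 <= s -> measurable_fun setT (fun w => phi (X s w)).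
Proof.
move=> s0 _ B mB; rewrite setTI.
apply: (filtration_sub (bm_filtration bm) s0); exact: path_measurable_wrt.
Qed.

Definition zero_time : Om -> \bar R := hitting_time (fun s w => phi (X s w)) [set (0 : R)].

Lemma zero_time_lt_measurable (t : R) : phi None != 0 -> 0 <= t ->
  F t [set w | (zero_time w < t%:E)%E].
Proof.
move=> phiN t0.
have sF := filtration_sigma (bm_filtration bm) t0.
have -> : [set w | (zero_time w < t%:E)%E] =
    [set w | exists s, [/\ 0 < s, s < t & phi (X s w) = 0]].
  have E w := hitting_time_lt (fun s w => phi (X s w)) [set (0 : R)] w t.
  by apply/seteqP; split=> w /=; [move=> /(E w).1|move=> h; apply/(E w)].
apply: (@hitting_zero_measurable _ _ _ sF _ (fun s => [set w | X s w <> None])).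
- move=> s s0 st B mB; apply: (filtration_le (bm_filtration bm) (ltW s0) (ltW st)).
  exact: path_measurable_wrt (ltW s0) _ mB.
- move=> s s0 st; apply: (filtration_le (bm_filtration bm) (ltW s0) (ltW st)).
  have -> : [set w | X s w <> None] = (alive_ind \o X s) @^-1` (~` [set 0]).
    by apply/seteqP; split=> w /alive_indP.
  apply: (comp_measurable_wrt (bm_adapted bm (ltW s0))
    (continuous_borel alive_ind_continuous)).
  by apply: measurableC; exact: measurable_set1.
- by move=> w a c a0 Xc; apply: path_continuous_alive => //; exact: ltW.
move=> w s s0 Xs.
have Xs' : X s w <> None by move=> XN; move: phiN; rewrite -XN Xs eqxx.
have [u su hu] := alive_right (ltW s0) Xs'.
by exists u => // c sc; apply: hu; exact: ltW.
Qed.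

(** Hitting times are stopping times since the filtration is right continuous. *)
Lemma zero_time_stopping : phi None != 0 -> stopping_time F zero_time.
Proof.
move=> phiN; split=> [w|t t0]; first exact: hitting_time_ge0.
rewrite (bm_right_continuous_filtration bm t0) => s /= ts.
have s0 : 0 <= s by rewrite ltW// (le_lt_trans t0).
have sF := filtration_sigma (bm_filtration bm) s0.
have -> : [set w | (zero_time w <= t%:E)%E] =
    \bigcap_n [set w | (zero_time w < (t + (s - t) / n.+1%:R)%:E)%E].
  apply/seteqP; split=> [w /= h n _ /=|w h].
    by rewrite (le_lt_trans h)// lte_fin ltrDl divr_gt0// subr_gt0.
  apply/lee_addgt0Pr => e e0.
  have st0 : 0 < s - t by rewrite subr_gt0.
  have [n _ /(_ n (leqnn n)) hn] := near_infty_natSinv_lt (PosNum (divr_gt0 e0 st0)).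
  apply: ltW; apply: (lt_le_trans (h n I)); rewrite -EFinD lee_fin lerD2l.
  by rewrite mulrC -ler_pdivlMr ?subr_gt0// ltW.
apply: (sigma_bigcap sF) => n.
have tn : t + (s - t) / n.+1%:R <= s.
  by rewrite -lerBrDl ler_pdivrMr// ler_peMr ?subr_ge0 ?(ltW ts)// ler1n.
have t0n : 0 <= t + (s - t) / n.+1%:R by rewrite addr_ge0// divr_ge0// subr_ge0 ltW.
exact: (filtration_le (bm_filtration bm) t0n tn (zero_time_lt_measurable phiN t0n)).
Qed.

Lemma zero_time_fin (w : Om) (s : R) : zero_time w = s%:E -> phi (X s w) = 0.
Proof.
move=> hs; have s0 : 0 <= s.
  by rewrite -lee_fin -hs; exact: hitting_time_ge0.
by apply: (@hitting_time_zero _ _ _ (fun s w => phi (X s w))) hs => //; exact: path_right_continuous.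
Qed.

End Paths.

(** * The strong Markov property with a random delay *)

Section Markov.
Context {R : realType} {G : metric_graph R}.
Context {d : measure_display} {Om : measurableType d}.
Variables (P : gpoint G -> probability Om R) (F : R -> set (set Om)).
Variables (X : R -> Om -> cemetery (gpoint G)) (theta : R -> Om -> Om).
Hypothesis bm : brownian_motion P F X theta.
Local Notation U := (transition_semigroup P X).

Lemma ext0_continuous (f : gpoint G -> R) : continuous f -> continuous (ext0 f).
Proof. exact: (@extc_continuous _ _ 0). Qed.

Lemma ext0_norm_le (f : gpoint G -> R) (M : R) (p : cemetery (gpoint G)) :
  0 <= M -> (forall q, `|f q| <= M) -> `|ext0 f p| <= M.
Proof. by move=> M0 fM; case: p => [p|] /=; [exact: fM|rewrite normr0]. Qed.

Lemma C0_bounded_measurable (f : gpoint G -> R) : C0 f -> bounded_measurable f.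
Proof.
move=> fC; split; first by apply: continuous_borel; case: fC.
by have [M _ fM] := C0_bounded fC; exists M.
Qed.

Lemma semigroupE (t : R) (f : gpoint G -> R) (xi : gpoint G) :
  U t f xi = \int[P xi]_w ext0 f (X t w).
Proof. by rewrite /transition_semigroup unlock. Qed.

Lemma ext0_path_measurable (f : gpoint G -> R) (t : R) : C0 f -> 0 <= t ->
  measurable_fun setT (fun w => ext0 f (X t w)).
Proof.
move=> fC; apply: (path_measurable bm); apply: ext0_continuous; by case: fC.
Qed.

Lemma ext0_path_integrable (f : gpoint G -> R) (t : R) (xi : gpoint G) : C0 f -> 0 <= t ->
  (P xi).-integrable setT (EFin \o (fun w => ext0 f (X t w))).
Proof.
move=> fC t0; have [M M0 fM] := C0_bounded fC.
apply: (@bounded_integrable _ _ _ _ _ _ M) => //; first exact: ext0_path_measurable.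
by move=> w; apply: ext0_norm_le => //; exact: ltW.
Qed.

Lemma semigroup_norm_le (t M : R) (f : gpoint G -> R) (xi : gpoint G) : C0 f -> 0 <= t ->
  0 <= M -> (forall p, `|f p| <= M) -> `|U t f xi| <= M.
Proof.
move=> fC t0 M0 fM; rewrite semigroupE.
have := @Rintegral_norm_le _ _ _ (P xi) setT (fun w => ext0 f (X t w)) M measurableT
  (ext0_path_integrable xi fC t0) (fun w _ => ext0_norm_le _ M0 fM).
by move=> /le_trans; apply; rewrite ler_piMr// pr_le1.
Qed.

(** The singleton of a point is Borel because it is a zero set. *)
Lemma starts_at (xi : gpoint G) : measurable [set w | X 0 w = Some xi] /\
  pr (P xi) (~` [set w | X 0 w = Some xi]) = 0.
Proof.
have [a [b [m [anchor [m0 ab _ ab0 _]]]]] := local_distance xi.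
have mS : measurable [set w | X 0 w = Some xi].
  have -> : [set w | X 0 w = Some xi] = (fun w => extc 1 (glue a b) (X 0 w)) @^-1` [set 0].
    apply/seteqP; split=> w /=; first by move=> -> /=; apply/ab0.
    by case: (X 0 w) => /= [p /ab0 ->//|/eqP]; rewrite oner_eq0.
  rewrite -[X in measurable X]setTI; apply: (path_measurable bm) => //.
  by apply: extc_continuous; exact: glue_continuous.
split=> //; rewrite pr_setC// /pr (bm_normal bm).
by rewrite subrr.
Qed.

Lemma Rintegral_starts (xi : gpoint G) (g : Om -> R) (c : R) (M : R) :
  measurable_fun setT g -> (forall w, `|g w| <= M) ->
  (forall w, X 0 w = Some xi -> g w = c) -> \int[P xi]_w g w = c.
Proof.
move=> mg gM gc; have [mS pS] := starts_at xi.
have ig := @bounded_integrable _ _ _ (P xi) setT g M measurableT mg gM.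
rewrite (Rintegral_setC_split mS ig).
rewrite (@eq_Rintegral _ _ _ _ _ (cst c)); last by move=> w; rewrite inE => /gc.
have p1 : pr (P xi) [set w | X 0 w = Some xi] = 1 by rewrite /pr (bm_normal bm).
rewrite Rintegral_cst// -[fine _]/(pr (P xi) [set w | X 0 w = Some xi]) p1 mulr1.
have := @Rintegral_norm_le _ _ _ (P xi) (~` [set w | X 0 w = Some xi]) g M.
rewrite pS mulr0 normr_le0 => h; rewrite (eqP (h _ _ _)) ?addr0//.
- exact: measurableC.
- by apply: (@bounded_integrable _ _ _ _ _ _ M) => //; exact: measurableC.
Qed.

Lemma semigroup0 (f : gpoint G -> R) (xi : gpoint G) : C0 f -> U 0 f xi = f xi.
Proof.
move=> fC; have [M M0 fM] := C0_bounded fC; rewrite semigroupE.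
apply: (@Rintegral_starts _ _ _ M); first exact: ext0_path_measurable.
  by move=> w; apply: ext0_norm_le => //; exact: ltW.
by move=> w ->.
Qed.

Lemma constant_stopping_time (s : R) : 0 <= s -> stopping_time F (fun=> s%:E).
Proof.
move=> s0; split=> // t t0; have sF := filtration_sigma (bm_filtration bm) t0.
have [st|st] := leP s t.
  rewrite (_ : [set _ | _] = setT); first exact: sigma_setT sF.
  by apply/seteqP; split=> // w _ /=; rewrite lee_fin.
rewrite (_ : [set _ | _] = set0); first exact: sigma_set0 sF.
by apply/seteqP; split=> // w /=; rewrite lee_fin leNgt st.
Qed.

Section AtStoppingTime.
Variable H : Om -> \bar R.
Hypothesis stopH : stopping_time F H.

Lemma stopped_sigma_le (c : R) : stopped_sigma F H [set w | (H w <= c%:E)%E].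
Proof.
have [H0 mH] := stopH; have [c0|c0] := leP 0 c; last first.
  rewrite (_ : [set w | _] = set0); last first.
    apply/seteqP; split=> // w /= h; have := le_trans (H0 w) h.
    by rewrite lee_fin leNgt c0.
  split=> [|t t0]; first exact: measurable0.
  by rewrite set0I; exact: sigma_set0 (filtration_sigma (bm_filtration bm) t0).
split=> [|t t0]; first exact: (filtration_sub (bm_filtration bm) c0 (mH _ c0)).
have ct0 : 0 <= Num.min c t by rewrite le_min c0 t0.
have -> : [set w | (H w <= c%:E)%E] `&` [set w | (H w <= t%:E)%E] =
    [set w | (H w <= (Num.min c t)%:E)%E].
  apply/seteqP; split=> w /=; rewrite EFin_min le_min; first by move=> [-> ->].
  by move=> /andP[].
by apply: (filtration_le (bm_filtration bm) ct0 _ (mH _ ct0)); rewrite ge_min lexx orbT.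
Qed.

Lemma stopped_sigmaD (A B : set Om) : stopped_sigma F H A -> stopped_sigma F H B ->
  stopped_sigma F H (A `\` B).
Proof.
move=> [mA FA] [mB FB]; split=> [|t t0]; first exact: measurableD.
have sF := filtration_sigma (bm_filtration bm) t0.
have -> : (A `\` B) `&` [set w | (H w <= t%:E)%E] =
    (A `&` [set w | (H w <= t%:E)%E]) `&` ~` (B `&` [set w | (H w <= t%:E)%E]).
  apply/seteqP; split=> w /=; first by move=> [[? ?] ?]; split=> // -[].
  by move=> [[? ?] h]; split=> //; split=> // ?; apply: h.
by apply: (sigma_setI sF); [exact: FA|apply: (sigma_setC sF); exact: FB].
Qed.

Definition shifted (f : gpoint G -> R) (s : R) (w : Om) : R :=
  ext0 f (at_time X (fun w => H w + s%:E)%E w).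

Definition predicted (f : gpoint G -> R) (s : R) (w : Om) : R :=
  ext0 (U s f) (at_time X H w).

Lemma markov_integrals (f : gpoint G -> R) (s : R) (xi : gpoint G) : C0 f -> 0 <= s ->
  [/\ (P xi).-integrable setT (EFin \o shifted f s),
      (P xi).-integrable setT (EFin \o predicted f s) &
      forall A, stopped_sigma F H A ->
        \int[P xi]_(w in A) shifted f s w = \int[P xi]_(w in A) predicted f s w].
Proof.
move=> fC s0; have := bm_strong_markov bm xi stopH s0 (C0_bounded_measurable fC).
by case.
Qed.

(** If, at the points visited at the stopping time [H], the function
    [s |-> U s f] stays close to its value at [r] during the possible
    remaining times [t - H], then conditioning on the past of [H] replaces
    [f (X t)] by [U r f (X H)]. The remaining time is random while the Markov
    property is about fixed delays, so it is rounded up to a grid; right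
    continuity of the paths removes the rounding. *)
Lemma markov_compare (f : gpoint G -> R) (xi : gpoint G) (delta t r k : R) :
  C0 f -> 0 <= delta -> delta <= t -> 0 <= r -> 0 <= k ->
  (forall w s, (H w <= delta%:E)%E -> t - delta <= s -> s <= t ->
     `|predicted f s w - predicted f r w| <= k) ->
  `|\int[P xi]_(w in [set w | (H w <= delta%:E)%E])
      (ext0 f (X t w) - predicted f r w)| <= k.
Proof.
move=> fC delta0 deltat r0 k0 close.
set B := [set w | (H w <= delta%:E)%E].
have [M M0 fM] := C0_bounded fC.
have t0 : 0 <= t by exact: le_trans deltat.
have [sB mB] : stopped_sigma F H B /\ measurable B by split; have [] := stopped_sigma_le delta.
have predM s w : 0 <= s -> `|predicted f s w| <= M.
  move=> s0; apply: ext0_norm_le => [|p]; first exact: ltW.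
  by apply: semigroup_norm_le => //; exact: ltW.
have shiftM s w : `|shifted f s w| <= M by apply: ext0_norm_le => //; exact: ltW.
pose h (n : nat) : R := n.+1%:R^-1.
have h0 n : 0 < h n by rewrite invr_gt0.
(* [A n i] is the part of [B] where [H] is in the interval of length [h n] that
   ends at [i * h n], and [q n i] is the rounded delay used there; for [i = 0],
   where the interval starts below zero, it only contains the time zero *)
pose lag n (i : nat) : R := (i%:R - 1) * h n.
pose A n (i : nat) : set Om :=
  [set w | (H w <= (Num.min delta (i%:R * h n))%:E)%E] `\` [set w | (H w <= (lag n i)%:E)%E].
have sA n i : stopped_sigma F H (A n i) by apply: stopped_sigmaD; exact: stopped_sigma_le.
have mA n i : measurable (A n i) by have [] := sA n i.
pose q n i : R := Num.max 0 (t - Num.max 0 (lag n i)).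
have q0 n i : 0 <= q n i by rewrite le_max lexx.
have onA n i w : A n i w -> exists x, [/\ H w = x%:E, x <= delta, lag n i < x,
    x <= i%:R * h n & [/\ t - delta <= q n i, q n i <= t, t <= x + q n i & x + q n i <= t + h n]].
  move=> [/= + /negP]; rewrite -ltNge.
  have := stopH.1 w; case: (H w) => // x; rewrite !(lee_fin, lte_fin) le_min => x0 /andP[xd xih] lx.
  exists x; split=> //; rewrite /q.
  have ih : i%:R * h n = lag n i + h n by rewrite /lag mulrBl mul1r subrK.
  have [l0|l0] := leP (lag n i) 0.
    by rewrite subr0 max_r//; split; move: xih; rewrite ?ih; lra.
  by rewrite max_r; [split|]; move: xih; rewrite ?ih; lra.
have tA n : trivIset setT (A n).
  have aux i j w : (i < j)%N -> A n i w -> A n j w -> False.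
    move=> ij /onA[x [Hx _ _ xih _]] /onA[y [Hy _ yj _ _]].
    have xy : x = y by apply: EFin_inj; rewrite -Hx -Hy.
    move: yj; rewrite -xy ltNge (le_trans xih)//.
    by rewrite /lag ler_wpM2r ?(ltW (h0 n))// lerBrDr natr1 ler_nat.
  apply/trivIsetP => i j _ _ ij; apply/seteqP; split=> // w [Ai Aj].
  by case: (ltngtP i j) ij => // h' _; [exact: aux h' Ai Aj|exact: aux h' Aj Ai].
pose N n := (Num.truncn (delta * n.+1%:R)).+2.
have coverB n w : B w -> exists2 i, (i < N n)%N & A n i w.
  rewrite /B /A/=; have := stopH.1 w; case Hw: (H w) => [x| |]// x0 xd.
  rewrite !lee_fin in x0 xd.
  have ex : exists i : nat, x <= i%:R * h n.
    exists (Num.truncn (x * n.+1%:R)).+1; rewrite ler_pdivlMr//.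
    by rewrite ltW// truncnS_gt.
  case: (ex_minnP ex) => i xih imin; exists i; last first.
    split; rewrite /= lee_fin; first by rewrite le_min xd xih.
    rewrite /lag => hi; case: i xih imin hi => [|i] xih imin.
      by rewrite sub0r mulN1r => hi; have := h0 n; lra.
    by rewrite -natr1 addrK => /imin; rewrite ltnn.
  rewrite ltnS; case: i xih imin => [//|i] xih imin; rewrite ltnS.
  have : i%:R * h n < x.
    by rewrite ltNge; apply/negP => /imin; rewrite ltnn.
  rewrite ltr_pdivrMr// => ix; rewrite truncn_ge_nat ?mulr_ge0//.
  by rewrite (le_trans (ltW ix))// ler_wpM2r.
pose D n i w := shifted f (q n i) w - predicted f r w.
pose g n w := \sum_(i < N n) \1_(A n i) w * D n i w.
have iS n i : (P xi).-integrable setT (EFin \o shifted f (q n i)).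
  by have [] := markov_integrals xi fC (q0 n i).
have iP s : 0 <= s -> (P xi).-integrable setT (EFin \o predicted f s).
  by move=> s0; have [] := markov_integrals xi fC s0.
have iD n i : (P xi).-integrable setT (EFin \o D n i).
  by have := integrableB measurableT (iS n i) (iP r r0); apply: eq_integrable.
have sub_int (E : set Om) (u : Om -> R) : measurable E ->
    (P xi).-integrable setT (EFin \o u) -> (P xi).-integrable E (EFin \o u).
  by move=> mE; apply: integrableS => //; exact: subsetT.
have gOn n i w : A n i w -> (i < N n)%N -> g n w = D n i w.
  move=> Ai iN; rewrite /g (bigD1 (Ordinal iN))//= indicE mem_set// mul1r.
  rewrite big1 ?addr0// => j ji; rewrite indicE memNset ?mul0r// => Aj.
  have /trivIsetP/(_ i j I I) := tA n; rewrite eq_sym => /(_ ji) e.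
  by have : set0 w by rewrite -e.
have gM n w : `|g n w| <= M + M.
  have [[i iN Ai]|no] := pselect (exists2 i, (i < N n)%N & A n i w).
    by rewrite (gOn n i w)// (le_trans (ler_normB _ _))// lerD// predM.
  rewrite /g big1 ?normr0 ?addr_ge0 ?ltW// => i _.
  by rewrite indicE memNset ?mul0r// => Ai; apply: no; exists i.
have /all_and2[ig gk] n : (P xi).-integrable setT (EFin \o g n) /\
    `|\int[P xi]_w g n w| <= k.
  apply: Rintegral_pieces_le => // i.
  have -> : \int[P xi]_(x in A n i) D n i x =
      \int[P xi]_(x in A n i) (predicted f (q n i) x - predicted f r x).
    have [_ _ eqA] := markov_integrals xi fC (q0 n i).
    have iPr := sub_int _ _ (mA n i) (iP r r0).
    rewrite (RintegralB (mA n i) (sub_int _ _ (mA n i) (iS n i)) iPr).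
    by rewrite (RintegralB (mA n i) (sub_int _ _ (mA n i) (iP _ (q0 n i))) iPr) eqA.
  apply: Rintegral_norm_le => //.
    apply: sub_int => //.
    by have := integrableB measurableT (iP _ (q0 n i)) (iP r r0); apply: eq_integrable.
  move=> w /onA[x [Hx xd _ _ [q1 q2 _ _]]]; apply: close => //.
  by rewrite Hx lee_fin.
have mg n : measurable_fun setT (g n) by apply/measurable_EFinP; exact: measurable_int (ig n).
have ml : measurable_fun setT (fun w => ext0 f (X t w) - predicted f r w).
  apply: measurable_funB; first exact: ext0_path_measurable.
  by apply/measurable_EFinP; exact: measurable_int (iP r r0).
have lim : \int[P xi]_(w in B) g n w @[n --> \oo] -->
    \int[P xi]_(w in B) (ext0 f (X t w) - predicted f r w).
  apply: (@bounded_convergence _ _ _ (P xi) B g _ (M + M)) => // w Bw.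
  apply/cvgrPdist_le => e e0.
  have rc : ext0 f (X u w) @[u --> t^'+] --> ext0 f (X t w).
    by apply: (path_right_continuous bm) => //; apply: ext0_continuous; case: fC.
  have /cvgrPdist_le/(_ e e0)[eta /= eta0 heta] := rc.
  have [n0 _ hn0] := near_infty_natSinv_lt (PosNum eta0).
  exists n0 => // n /= n0n; have [i iN Ai] := coverB n w Bw.
  rewrite (gOn n i w)// (_ : _ - _ = ext0 f (X t w) - shifted f (q n i) w); last by rewrite /D; ring.
  have [x [Hx xd _ _ [_ _ tx xt]]] := onA n i w Ai.
  rewrite /shifted /at_time Hx -EFinD.
  move: tx; rewrite le_eqVlt => /orP[/eqP <-|tx]; first by rewrite subrr normr0 ltW.
  apply: heta => //; rewrite /ball/= distrC gtr0_norm ?subr_gt0// ltrBlDl.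
  by rewrite (le_lt_trans xt)// ltrD2l; exact: hn0.
have gB n : \int[P xi]_(w in B) g n w = \int[P xi]_w g n w.
  rewrite (Rintegral_setC_split mB (ig n)) [X in _ = _ + X](_ : _ = 0) ?addr0//.
  rewrite (@eq_Rintegral _ _ _ _ _ (cst 0)) ?Rintegral_cst ?mul0r//; first exact: measurableC.
  move=> w; rewrite inE => nB; rewrite /g big1// => i _.
  rewrite indicE memNset ?mul0r// => /onA[x [Hx xd _ _ _]].
  by apply: nB; rewrite /B/= Hx lee_fin.
rewrite leNgt -subr_gt0; apply/negP => kl.
have nl : `|\int[P xi]_(w in B) g n w| @[n --> \oo] -->
    `|\int[P xi]_(w in B) (ext0 f (X t w) - predicted f r w)| by exact: cvg_norm lim.
have /cvgrPdist_lt/(_ _ kl)[n _ /(_ n (leqnn n))] /= := nl.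
by rewrite gB ltr_norml => /andP[_]; have := gk n; lra.
Qed.

End AtStoppingTime.

End Markov.

(** * Stopped processes and the transfer from Brownian motion *)

Section StoppedTime.
Context {R : realType} {d : measure_display} {Om : measurableType d}.
Implicit Types (H : Om -> \bar R) (t : R) (w : Om).

(** Isolated as a real random variable, so that a stopped process is a process
    at a measurable random time. *)
Definition stopped_at H t w : R := fine (Order.min t%:E (H w)).

Lemma stopped_at_le H t w : (0 <= H w)%E -> (H w <= t%:E)%E ->
  (stopped_at H t w)%:E = H w.
Proof.
rewrite /stopped_at => H0 Ht; rewrite min_r// fineK//.
by rewrite ge0_fin_numE// (le_lt_trans Ht)// ltry.
Qed.

Lemma stopped_at_ge H t w : (t%:E <= H w)%E -> stopped_at H t w = t.
Proof. by rewrite /stopped_at => tH; rewrite min_l. Qed.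

Lemma stopped_at_itv H t w : (0 <= H w)%E -> 0 <= t ->
  0 <= stopped_at H t w /\ stopped_at H t w <= t.
Proof.
move=> H0 t0; have [tH|Ht] := leP t%:E (H w); first by rewrite stopped_at_ge.
by rewrite -!lee_fin stopped_at_le ?(ltW Ht).
Qed.

Lemma stopped_at_measurable H t : 0 <= t -> (forall w, (0 <= H w)%E) ->
  (forall c, 0 <= c -> measurable [set w | (H w < c%:E)%E]) ->
  measurable_fun setT (stopped_at H t).
Proof.
move=> t0 H0 mH; apply: (measurability _ (RGenInftyO.measurableE R)) => _ [_ [c ->] <-].
rewrite setTI; have [c0|c0] := leP c 0.
  rewrite [X in measurable X](_ : _ = set0); first exact: measurable0.
  apply/seteqP; split=> // w /=; rewrite in_itv/= ltNge (le_trans c0)//.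
  by have [] := stopped_at_itv (H0 w) t0.
have [tc|ct] := ltP t c.
  rewrite [X in measurable X](_ : _ = setT); first exact: measurableT.
  apply/seteqP; split=> // w _ /=; rewrite in_itv/= (le_lt_trans _ tc)//.
  by have [] := stopped_at_itv (H0 w) t0.
rewrite [X in measurable X](_ : _ = [set w | (H w < c%:E)%E]); first exact: mH (ltW c0).
apply/seteqP; split=> w /=; rewrite in_itv/= -lte_fin.
  have [tH|Ht] := leP t%:E (H w); last by rewrite stopped_at_le// ltW.
  by rewrite stopped_at_ge// lte_fin ltNge ct.
by move=> Hc; rewrite stopped_at_le// (le_trans (ltW Hc))// lee_fin.
Qed.

Lemma stoppedE (E : Type) (Z : R -> Om -> E) H t w :
  stopped Z H t w = Z (stopped_at H t w) w.
Proof. by []. Qed.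

End StoppedTime.

Section BrownianStopped.
Context {R : realType} {G : metric_graph R} (l : edge G).
Context {d : measure_display} {Om : measurableType d}.
Variables (Q : probability Om R) (W : R -> Om -> R) (x : R).
Hypothesis bmW : standard_brownian Q W x.

Definition exit_time : Om -> \bar R := hitting_time W (edge_endpoints l).

Lemma edge_endpointsP (y : R) : edge_endpoints l y <-> tent l y = 0.
Proof.
case: (l) => [i|e] //=; have := ilen_gt0 i; split=> [[->|->]|].
- by rewrite subr0 min_l// ltW.
- by rewrite subrr min_r// ltW.
- by rewrite /Num.min; case: ifP => _ h; [left|right; lra].
Qed.

Lemma bm_comp_continuous (phi : R -> R) (w : Om) (a b : R) : 0 <= a -> continuous phi ->
  {within `[a, b], continuous (fun s => phi (W s w))}.
Proof.
move=> a0 phic.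
have sub : [set` `[a, b]] `<=` [set` `[0, +oo[].
  by move=> t; rewrite /= !in_itv/= andbT => /andP[/(le_trans a0)].
have Wc := continuous_subspaceW sub (@sb_continuous _ _ _ _ _ _ bmW w).
by move=> t; apply: continuous_comp; [exact: Wc|exact: phic].
Qed.

Lemma bm_right_cvg (phi : R -> R) (w : Om) (s : R) : 0 <= s -> continuous phi ->
  phi (W u w) @[u --> s^'+] --> phi (W s w).
Proof.
move=> s0 phic; have : W u w @[u --> s^'+] --> W s w.
  apply/cvgrPdist_lt => e e0.
  have [eta eta0 h] := bm_path_continuous bmW w s0 e0.
  exists eta => //= u us su; rewrite distrC; apply: h; first by rewrite ltW// (le_lt_trans s0).
  by rewrite distrC.
by move=> h; exact: (cvg_comp _ _ h (@phic (W s w))).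
Qed.

Lemma tent_continuous : continuous (tent l).
Proof.
move=> y; apply/cvgrPdist_lt => e e0; exists e => //= z.
by rewrite /ball/=; apply: le_lt_trans; exact: tent_lip.
Qed.

Lemma exit_timeE : exit_time = hitting_time (fun s w => tent l (W s w)) [set (0 : R)].
Proof.
apply/funext => w; congr ereal_inf; apply/seteqP.
by split=> _ [t [t0 /edge_endpointsP Wt] <-]; exists t.
Qed.

Lemma exit_time_lt_measurable (c : R) : 0 <= c ->
  measurable [set w | (exit_time w < c%:E)%E].
Proof.
move=> c0; have -> : [set w | (exit_time w < c%:E)%E] =
    [set w | exists s, [/\ 0 < s, s < c & tent l (W s w) = 0]].
  have E w := hitting_time_lt (fun s w => tent l (W s w)) [set (0 : R)] w c.
  by rewrite exit_timeE; apply/seteqP; split=> w /=; [move=> /(E w).1|move=> h; apply/(E w)].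
apply: (@hitting_zero_measurable _ _ measurable (@sigma_algebra_measurable _ Om)
  (fun s w => tent l (W s w)) (fun=> setT)).
- move=> s s0 _ B mB; rewrite -[X in measurable X]setTI.
  have mt : measurable_fun setT (tent l) by apply: continuous_measurable_fun; exact: tent_continuous.
  exact: (measurableT_comp mt (sb_measurable bmW (ltW s0))).
- by move=> *; exact: measurableT.
- by move=> w a b a0 _; apply: bm_comp_continuous; [exact: ltW|exact: tent_continuous].
- by move=> w s _ _; exists (s + 1); rewrite // ltrDl.
Qed.

Lemma bm_stopped_measurable (phi : R -> R) (t : R) : 0 <= t -> continuous phi ->
  measurable_fun setT (fun w => phi (stopped W exit_time t w)).
Proof.
move=> t0 phic.
apply: (@random_time_measurable _ _ _ (fun s w => phi (W s w)) (stopped_at exit_time t)).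
- move=> s s0; apply: measurableT_comp; first exact: continuous_measurable_fun.
  exact: (sb_measurable bmW).
- by move=> w s s0; exact: bm_right_cvg.
- by move=> w; have [] := @stopped_at_itv _ _ _ exit_time t w (hitting_time_ge0 _ _ _) t0.
- apply: stopped_at_measurable => // [w|c]; first exact: hitting_time_ge0.
  exact: exit_time_lt_measurable.
Qed.

End BrownianStopped.

Section GraphStopped.
Context {R : realType} {G : metric_graph R}.
Context {d : measure_display} {Om : measurableType d}.
Variables (P : gpoint G -> probability Om R) (F : R -> set (set Om)).
Variables (X : R -> Om -> cemetery (gpoint G)) (theta : R -> Om -> Om).
Hypothesis bm : brownian_motion P F X theta.

Definition vertex_time : Om -> \bar R := hitting_time X (@vertices R G).

Definition vertex_coord : cemetery (gpoint G) -> R := extc 1 (@vertex_dist R G).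

Lemma vertex_coord_continuous : continuous vertex_coord.
Proof.
by apply: extc_continuous; apply: glue_continuous; exact: vertex_dist_glueable.
Qed.

Lemma verticesP (p : cemetery (gpoint G)) : vertices p <-> vertex_coord p = 0.
Proof.
split=> [[v _ <-]//|]; case: p => [p /= /vertex_dist_eq0[v ->]|/eqP]; first by exists v.
by rewrite oner_eq0.
Qed.

Lemma vertex_timeE : vertex_time = zero_time X vertex_coord.
Proof.
apply/funext => w; congr ereal_inf; apply/seteqP.
by split=> _ [t [t0 /verticesP Xt] <-]; exists t.
Qed.

Lemma vertex_time_stopping : stopping_time F vertex_time.
Proof.
rewrite vertex_timeE; apply: (zero_time_stopping bm); first exact: vertex_coord_continuous.
by rewrite /= oner_neq0.
Qed.

Lemma vertex_time_fin (w : Om) (s : R) : vertex_time w = s%:E -> vertices (X s w).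
Proof.
rewrite vertex_timeE => h; apply/verticesP.
by apply: (zero_time_fin bm) h; exact: vertex_coord_continuous.
Qed.

Lemma graph_stopped_measurable (phi : cemetery (gpoint G) -> R) (t : R) : 0 <= t ->
  continuous phi -> measurable_fun setT (fun w => phi (stopped X vertex_time t w)).
Proof.
move=> t0 phic.
apply: (@random_time_measurable _ _ _ (fun s w => phi (X s w)) (stopped_at vertex_time t)).
- by move=> s s0; exact: (path_measurable bm).
- by move=> w s s0; exact: (path_right_continuous bm).
- by move=> w; have [] := @stopped_at_itv _ _ _ vertex_time t w (hitting_time_ge0 _ _ _) t0.
- apply: stopped_at_measurable => // [w|c c0]; first exact: hitting_time_ge0.
  rewrite vertex_timeE; apply: (filtration_sub (bm_filtration bm) c0).
  apply: (zero_time_lt_measurable bm) => //; first exact: vertex_coord_continuous.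
  by rewrite /= oner_neq0.
Qed.

(** A path property of the absorbed Brownian motion on an edge, read off
    finitely many times, holds for the process on the graph with the same
    probability: the only way in which the local description enters. *)
Lemma transfer (l : edge G) (x : R) (lx : x \in edge_interior l) (N : nat)
    (tt : 'I_N -> R) (phi : cemetery (gpoint G) -> R) (M : set R) (e : R) :
  (forall i, 0 <= tt i) -> continuous phi -> measurable M ->
  (forall (d' : measure_display) (Om' : measurableType d') (Q : probability Om' R)
      (W : R -> Om' -> R), standard_brownian Q W x ->
    exists Bad : set Om', [/\ measurable Bad, pr Q Bad <= e &
      forall w, ~ Bad w -> exists i,
        M (phi (Some (edge_point l (stopped W (exit_time l W) (tt i) w))))]) ->
  exists Bad : set Om, [/\ measurable Bad, pr (P (Inner lx)) Bad <= e &
    forall w, ~ Bad w -> X 0 w = Some (Inner lx) /\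
      exists i, M (phi (stopped X vertex_time (tt i) w))].
Proof.
move=> tt0 phic mM hQ.
have [d' [Om' [Q [W [bmW eqPQ]]]]] := bm_locally_brownian bm lx.
have [Bad [mBad pBad hBad]] := hQ _ _ _ _ bmW.
pose E := [set w | forall i, ~ M (phi (stopped X vertex_time (tt i) w))].
pose E' := [set w | forall i, ~ M (phi (Some (edge_point l (stopped W (exit_time l W) (tt i) w))))].
have mE : measurable E.
  rewrite (_ : E = \bigcap_(i in [set: 'I_N]) ((fun w => phi (stopped X vertex_time (tt i) w)) @^-1` (~` M))).
    apply: fin_bigcap_measurable => // i _; rewrite -[X in measurable X]setTI.
    by apply: graph_stopped_measurable => //; exact: measurableC.
  by apply/seteqP; split=> [w h i _|w h i]; [exact: h|exact: h].
have mE' : measurable E'.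
  rewrite (_ : E' = \bigcap_(i in [set: 'I_N]) ((fun w => phi (Some (edge_point l (stopped W (exit_time l W) (tt i) w)))) @^-1` (~` M))).
    apply: fin_bigcap_measurable => // i _; rewrite -[X in measurable X]setTI.
    apply: (@bm_stopped_measurable _ _ l _ _ _ _ _ bmW (fun y => phi (Some (edge_point l y)))) => //; last exact: measurableC.
    move=> y; have h1 := @edge_point_continuous _ _ l y.
    have h2 := @continuous_Some _ _ phi phic (edge_point l y).
    exact: (cvg_comp _ _ h1 h2).
  by apply/seteqP; split=> [w h i _|w h i]; [exact: h|exact: h].
have EE' : pr (P (Inner lx)) E = pr Q E'.
  rewrite /pr; congr fine.
  apply: (eqPQ N tt (fun=> phi @^-1` (~` M))) => // i.
  by apply: (continuous_borel phic); exact: measurableC.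
have [mS pS] := starts_at bm (Inner lx).
exists (E `|` ~` [set w | X 0 w = Some (Inner lx)]); split.
- by apply: measurableU => //; exact: measurableC.
- rewrite (le_trans (pr_setU _ _ _))//; first exact: measurableC.
  rewrite pS addr0 EE' (le_trans _ pBad)//; apply: pr_le => // w E'w.
  by apply: contrapT => /hBad[i]; exact: E'w.
- move=> w /not_orP[nE /contrapT Xw]; split=> //.
  by apply: contrapT => h; apply: nE => i Mi; apply: h; exists i.
Qed.

End GraphStopped.

(** * Hitting points inside an edge *)

Section BrownianStart.
Context {R : realType} {d : measure_display} {Om : measurableType d}.
Variables (Q : probability Om R) (W : R -> Om -> R) (x : R).
Hypothesis bmW : standard_brownian Q W x.

Lemma bm_stays_close (t e : R) : 0 < t -> 0 < e ->
  exists Bad : set Om, [/\ measurable Bad,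
    pr Q Bad <= oscillation_const e * t ^+ 3 &
    forall w, ~ Bad w -> W 0 w = x /\
      forall s, 0 <= s -> s <= t -> `|W s w - x| <= e].
Proof.
move=> t0 e0; have [Bad [mB pB hB]] := bm_small_oscillation bmW t0 e0.
have mS : measurable [set w | W 0 w = x].
  have := sb_measurable bmW (lexx 0); move=> /(_ measurableT [set x] (measurable_set1 x)).
  by rewrite setTI.
have pS : pr Q (~` [set w | W 0 w = x]) = 0.
  by rewrite pr_setC// /pr (sb_start bmW) subrr.
exists (Bad `|` ~` [set w | W 0 w = x]); split.
- by apply: measurableU => //; exact: measurableC.
- rewrite (le_trans (pr_setU _ _ _))//; first exact: measurableC.
  by rewrite pS addr0.
- by move=> w /not_orP[nB /contrapT Wx]; split=> // s s0 st; rewrite -Wx; exact: hB.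
Qed.

End BrownianStart.

Section ShortTimes.
Context {R : realType}.

Lemma exists_short_time (c e delta : R) : 0 <= c -> 0 < e -> 0 < delta ->
  exists t, [/\ 0 < t, t <= delta & forall s, 0 <= s -> s <= t -> c * s ^+ 3 <= e].
Proof.
move=> c0 e0 d0; have c1 : 0 < c + 1 by rewrite ltr_wpDl.
exists (Num.min 1 (Num.min delta (e / (c + 1)))); split.
- by rewrite !lt_min ltr01 d0 divr_gt0.
- by rewrite !ge_min lexx orbT.
- move=> s s0; rewrite !le_min => /andP[s1 /andP[_ se]].
  have s3 : s ^+ 3 <= s by rewrite exprS ler_piMr ?exprn_ile1.
  rewrite (le_trans (ler_wpM2l c0 s3))//.
  rewrite ler_pdivlMr// in se; rewrite (le_trans _ se)// mulrC ler_wpM2l// lerDl//.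
Qed.

End ShortTimes.

Section Hitting.
Context {R : realType} {G : metric_graph R}.
Context {d : measure_display} {Om : measurableType d}.
Variables (P : gpoint G -> probability Om R) (F : R -> set (set Om)).
Variables (X : R -> Om -> cemetery (gpoint G)) (theta : R -> Om -> Om).
Hypothesis bm : brownian_motion P F X theta.

(** Before it leaves its edge the process moves away from its starting point
    with a probability that is small uniformly in this point. *)
Lemma graph_stays_close (l : edge G) (x : R) (lx : x \in edge_interior l) (t e : R)
    (phi : cemetery (gpoint G) -> R) (M : set R) : 0 < t -> 0 < e ->
  continuous phi -> measurable M ->
  (forall y, `|y - x| <= e -> M (phi (Some (edge_point l y)))) ->
  exists Bad : set Om, [/\ measurable Bad,
    pr (P (Inner lx)) Bad <= oscillation_const e * t ^+ 3 &
    forall w, ~ Bad w -> M (phi (stopped X (vertex_time X) t w))].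
Proof.
move=> t0 e0 phic mM hM.
have [|Bad [mB pB hB]] := @transfer _ _ _ _ _ _ _ _ bm l x lx 1 (fun=> t) phi M
  (oscillation_const e * t ^+ 3) (fun=> ltW t0) phic mM.
  move=> d' Om' Q W bmW; have [Bad [mB pB hB]] := bm_stays_close bmW t0 e0.
  exists Bad; split=> // w /hB[_ h]; exists ord0; apply: hM.
  have [s0 st] := @stopped_at_itv _ _ _ (exit_time l W) t w (hitting_time_ge0 _ _ _) (ltW t0).
  exact: h.
by exists Bad; split=> // w /hB[_ []].
Qed.

(** The hitting time is that of the zero set of any continuous [psi] that
    vanishes exactly at the point with coordinate [x0]. The point [x0] itself is
    excluded as a starting point: it may be a vertex, where the local description
    says nothing. *)
Definition hits_soon (l : edge G) (x0 : R) : Prop := forall delta e : R, 0 < delta -> 0 < e ->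
  exists2 eta, 0 < eta & forall (x : R) (lx : x \in edge_interior l), `|x - x0| < eta ->
    x != x0 -> forall psi : cemetery (gpoint G) -> R, continuous psi ->
    (forall p, psi p = 0 <-> p = Some (edge_point l x0)) ->
    exists Bad : set Om, [/\ measurable Bad, pr (P (Inner lx)) Bad <= e &
      forall w, ~ Bad w -> (zero_time X psi w <= delta%:E)%E].

(** Starting inside an edge close to a point [x0] inside the same edge: the
    Brownian motion soon crosses [x0] without leaving the edge, and so does the
    path on the graph, by the intermediate value theorem. *)
Lemma hits_inner_soon (l : edge G) (x0 : R) : x0 \in edge_interior l -> hits_soon l x0.
Proof.
move=> lx0 delta e delta0 e0; have e20 : 0 < e / 2 by rewrite divr_gt0.
have tx0 : 0 < tent l x0 by rewrite tent_gt0.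
pose r := tent l x0 / 2; have r0 : 0 < r by rewrite divr_gt0.
have r10 := oscillation_const_ge0 r0.
have [T [T0 Tdelta hT]] := exists_short_time r10 e20 delta0.
have [NN [tts [etas hb]]] : exists (N : bool -> nat) (tt : bool -> nat -> R) (eta : bool -> R),
  forall b, [/\ 0 < eta b, (forall i, 0 < tt b i), (forall i, tt b i <= T) &
  forall (d : measure_display) (Om : measurableType d) (Q : probability Om R)
    (W : R -> Om -> R) (x : R), standard_brownian Q W x ->
    exists Bad : set Om, [/\ measurable Bad, pr Q Bad <= e / 2 &
      forall w, ~ Bad w -> exists2 k, (k < N b)%N &
        eta b < (-1) ^+ b * (W (tt b k.+1) w - W 0 w)]].
  have [N1 [t1 [e1 h1]]] := bm_crosses_soon true T0 e20.
  have [N2 [t2 [e2 h2]]] := bm_crosses_soon false T0 e20.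
  exists (fun b => if b then N1 else N2), (fun b => if b then t1 else t2),
    (fun b => if b then e1 else e2).
  by case.
exists (Num.min r (Num.min (etas true) (etas false))).
  by rewrite !lt_min r0; have [-> _ _ _] := hb true; have [-> _ _ _] := hb false.
move=> x lx; rewrite !lt_min => /andP[xr /andP[xt xf]] xx0 psi psic psi0.
(* the direction in which [x0] is seen from [x]: downwards if [b] *)
pose b := x0 < x.
have bP : (b = true /\ x0 < x) \/ (b = false /\ x <= x0).
  by rewrite /b; case: ltP; [left|right].
have xb : `|x - x0| < etas b by case: (b).
have [eta0 tt0 ttT hQ] := hb b.
pose phi : cemetery (gpoint G) -> R := extc 0 (cross l x0).
have phic : continuous phi by apply: extc_continuous; apply: glue_continuous; exact: cross_glueable.
pose M : set R := [set y | 0 < (-1) ^+ b * y].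
have mM : measurable M by apply: measurable_lt_set => //; exact: measurable_funM.
have [|Bad [mB pB hB]] := @transfer _ _ _ _ _ _ _ _ bm l x lx (NN b) (fun i => tts b i.+1) phi M e
    (fun i => ltW (tt0 _)) phic mM.
  move=> d' Om' Q W bmW.
  have [Bad1 [mB1 pB1 hB1]] := bm_stays_close bmW T0 r0.
  have [Bad2 [mB2 pB2 hB2]] := hQ _ _ _ _ _ bmW.
  exists (Bad1 `|` Bad2); split; first exact: measurableU.
    rewrite (le_trans (pr_setU _ mB1 mB2))// [leRHS]splitr lerD// (le_trans pB1)//.
    by apply: hT => //; exact: ltW.
  move=> w /not_orP[/hB1[W0 near] /hB2[k kN]]; rewrite W0 => hk.
  exists (Ordinal kN) => /=; set t := tts b k.+1 in hk *.
  have inside s : 0 <= s -> s <= T -> 0 < tent l (W s w).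
    move=> s0 sT; have Ws := near s s0 sT.
    have := ler_normD (W s w - x) (x - x0); rewrite subrKA => tri.
    have := tent_lip l (W s w) x0; rewrite ler_norml => /andP[tl _].
    have rr : tent l x0 = r + r by exact: splitr.
    by rewrite rr in tl; lra.
  have tT : t <= T by exact: ttT.
  have tex : (t%:E <= exit_time l W w)%E.
    rewrite leNgt; apply/negP => /hitting_time_lt[s [s0 st /edge_endpointsP Ws]].
    by have := inside s (ltW s0) (le_trans (ltW st) tT); rewrite Ws ltxx.
  have lW : W t w \in edge_interior l by rewrite -tent_gt0 inside// ltW// /t.
  rewrite stoppedE stopped_at_ge// edge_point_inner.
  change (0 < (-1) ^+ b * cross l x0 (Inner lW)).
  move: hk xb; case: bP => -[-> x0x].
    by rewrite expr1 !mulN1r oppr_gt0 cross_lt0 gtr0_norm ?subr_gt0//; lra.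
  by rewrite expr0 !mul1r cross_gt0 distrC ger0_norm ?subr_ge0//; lra.
exists Bad; split=> // w /hB[X0 [i hi]].
set t := tts b i.+1 in hi; have t0 : 0 < t by exact: tt0.
have phin : phi (stopped X (vertex_time X) t w) != 0.
  by apply/eqP => h; move: hi; rewrite /M/= h mulr0 ltxx.
have tH : (t%:E < vertex_time X w)%E.
  rewrite ltNge; apply/negP => Ht.
  have Hs := stopped_at_le (hitting_time_ge0 X (@vertices R G) w) Ht.
  have [v _ vE] := vertex_time_fin bm (esym Hs).
  by move: phin; rewrite stoppedE -vE /= eqxx.
rewrite stoppedE stopped_at_ge in hi phin; last exact: ltW.
have Xt : X t w <> None by move=> h; move: phin; rewrite h eqxx.
have cont := path_continuous_alive bm phic (lexx 0) Xt.
have sgn0 : (-1) ^+ b * phi (X 0 w) < 0.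
  rewrite X0; change ((-1) ^+ b * cross l x0 (Inner lx) < 0).
  case: bP => -[-> x0x].
    by rewrite expr1 mulN1r oppr_lt0 cross_gt0.
  by rewrite expr0 mul1r cross_lt0 lt_neqAle xx0.
have [s sI phis] : exists2 s, s \in `[0, t] & phi (X s w) = 0.
  apply: (IVT (ltW t0) cont); move: hi sgn0; rewrite /M/= ge_min le_max.
  case: (b); rewrite ?expr1 ?expr0 ?mulN1r ?mul1r; lra.
move: sI; rewrite in_itv/= => /andP[s0 st].
have sn0 : s != 0.
  by apply/eqP => s00; move: sgn0; rewrite -[in X 0 w]s00 phis mulr0 ltxx.
have s_gt0 : 0 < s by rewrite lt_neqAle eq_sym sn0.
have Xs : X s w <> None.
  by move=> h; apply: Xt; exact: (bm_absorbing bm s0 st h).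
have Xp0 : X s w = Some (edge_point l x0).
  case Xsw : (X s w) Xs phis => [p|]// _ /(cross_eq0 lx0)[->|[v pv]].
    by rewrite edge_point_inner.
  have : (vertex_time X w <= s%:E)%E.
    by apply: hitting_time_le => //; exists v => //; rewrite Xsw pv.
  by rewrite leNgt (le_lt_trans _ tH)// lee_fin.
apply: (@le_trans _ _ s%:E); last by rewrite lee_fin (le_trans st)// (le_trans (ttT _)).
by apply: hitting_time_le => //; apply/psi0.
Qed.

End Hitting.

(** * Hitting the ends of an edge, and short-time continuity *)

Section HittingEnds.
Context {R : realType} {G : metric_graph R}.
Context {d : measure_display} {Om : measurableType d}.
Variables (P : gpoint G -> probability Om R) (F : R -> set (set Om)).
Variables (X : R -> Om -> cemetery (gpoint G)) (theta : R -> Om -> Om).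
Hypothesis bm : brownian_motion P F X theta.

(** At an end of an edge crossing means leaving the edge, and the stopped
    Brownian motion then stays at this end. *)
Lemma hits_end_soon (l : edge G) (x0 r : R) (b : bool) : 0 < r ->
  (forall y, tent l y = 0 -> `|y - x0| < r + r -> y = x0) ->
  (forall x y, x \in edge_interior l -> `|x - x0| < (-1) ^+ b * (y - x) -> tent l y < 0) ->
  edge_point l x0 = Vertex (if b then edge_initial l else edge_final l) ->
  hits_soon P X l x0.
Proof.
move=> r0 only beyond vx0 delta e delta0 e0; have e20 : 0 < e / 2 by rewrite divr_gt0.
have r10 := oscillation_const_ge0 r0.
have [T [T0 Tdelta hT]] := exists_short_time r10 e20 delta0.
have [N [tt [eta [eta0 tt0 ttT hQ]]]] := bm_crosses_soon b T0 e20.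
exists (Num.min r eta); first by rewrite lt_min r0.
move=> x lx; rewrite lt_min => /andP[xr xeta] xx0 psi psic psi0.
have [|Bad [mB pB hB]] := @transfer _ _ _ _ _ _ _ _ bm l x lx N (fun i => tt i.+1) psi [set 0] e
    (fun i => ltW (tt0 _)) psic (measurable_set1 0).
  move=> d' Om' Q W bmW.
  have [Bad1 [mB1 pB1 hB1]] := bm_stays_close bmW T0 r0.
  have [Bad2 [mB2 pB2 hB2]] := hQ _ _ _ _ _ bmW.
  exists (Bad1 `|` Bad2); split; first exact: measurableU.
    rewrite (le_trans (pr_setU _ mB1 mB2))// [leRHS]splitr lerD// (le_trans pB1)//.
    by apply: hT => //; exact: ltW.
  move=> w /not_orP[/hB1[W0 near] /hB2[k kN]]; rewrite W0 => hk.
  exists (Ordinal kN) => /=; set t := tt k.+1 in hk *.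
  have t0 : 0 < t by exact: tt0.
  have [s sI Ws] : exists2 s, s \in `[0, t] & tent l (W s w) = 0.
    have cont : {within `[0, t], continuous (fun s => tent l (W s w))}.
      by apply: (bm_comp_continuous bmW) => //; exact: tent_continuous.
    apply: (IVT (ltW t0) cont).
    have t1 : 0 < tent l (W 0 w) by rewrite W0 tent_gt0.
    have t2 : tent l (W t w) < 0 by apply: (beyond x) => //; exact: lt_trans hk.
    by rewrite ge_min le_max (ltW t1) (ltW t2) orbT.
  move: sI; rewrite in_itv/= => /andP[s0 st].
  have s_gt0 : 0 < s.
    rewrite lt_neqAle s0 andbT eq_sym; apply/eqP => s00.
    by have := lx; rewrite -tent_gt0 -W0 -[in W 0 w]s00 Ws ltxx.
  have ext : (exit_time l W w <= t%:E)%E.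
    apply: (@le_trans _ _ s%:E); last by rewrite lee_fin.
    by apply: hitting_time_le => //; apply/edge_endpointsP.
  apply/psi0; rewrite stoppedE; congr (Some (edge_point l _)).
  have := stopped_at_le (hitting_time_ge0 W (edge_endpoints l) w) ext.
  have [u0 ut] := @stopped_at_itv _ _ _ (exit_time l W) t w (hitting_time_ge0 _ _ _) (ltW t0).
  move: (stopped_at _ t w) u0 ut => u u0 ut uE.
  apply: only.
    apply: (@hitting_time_zero _ _ _ (fun s w => tent l (W s w))) => //.
      by apply: (bm_right_cvg bmW) => //; exact: tent_continuous.
    by rewrite -exit_timeE uE.
  have := near u u0 (le_trans ut (ttT _)).
  have := ler_normD (W u w - x) (x - x0); rewrite subrKA; lra.
exists Bad; split=> // w /hB[X0 [i /psi0 hi]].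
set t := tt i.+1 in hi; have t0 : 0 < t by exact: tt0.
have [s0 st] := @stopped_at_itv _ _ _ (vertex_time X) t w (hitting_time_ge0 _ _ _) (ltW t0).
rewrite stoppedE in hi; move: (stopped_at _ t w) s0 st hi => s s0 st Xs.
have s_gt0 : 0 < s.
  rewrite lt_neqAle s0 andbT eq_sym; apply/eqP => s00.
  by move: Xs; rewrite s00 X0 vx0.
apply: (@le_trans _ _ s%:E); last by rewrite lee_fin (le_trans st)// (le_trans (ttT _)).
by apply: hitting_time_le => //; apply/psi0.
Qed.

Lemma hits_edge_point_soon (l : edge G) (x0 : R) : x0 \in edge_interval l ->
  hits_soon P X l x0.
Proof.
move=> lx0; have [/(hits_inner_soon bm)//|] := boolP (x0 \in edge_interior l).
move: lx0; rewrite itv_edge_interval itv_edge_interior => /andP[].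
rewrite le_eqVlt => /orP[/eqP <- _ _|->/=].
  apply: (@hits_end_soon l 0 (if l is inl i then ilen i / 2 else 1) true).
  - by case: l => // i; rewrite divr_gt0// ilen_gt0.
  - move=> y /edge_endpointsP; case: l => [i [->//|->]|e ->//].
    by rewrite subr0 -splitr gtr0_norm ?ilen_gt0// ltxx.
  - move=> x y; rewrite subr0 expr1 mulN1r opprB itv_edge_interior => /andP[x0' h].
    rewrite gtr0_norm// => xy; have y0 : y < 0 by lra.
    by case: l h => [i|e] h //=; rewrite gt_min y0.
  - exact: edge_point_le0.
case: l => // i xi; rewrite -leNgt => ix.
have -> : x0 = ilen i by apply/le_anti/andP.
apply: (@hits_end_soon (inl i) (ilen i) (ilen i / 2) false).
- by rewrite divr_gt0// ilen_gt0.
- move=> y /edge_endpointsP[->|->//].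
  by rewrite sub0r normrN -splitr gtr0_norm ?ilen_gt0// ltxx.
- move=> x y; rewrite expr0 mul1r itv_edge_interior => /andP[x0' h].
  rewrite ltr0_norm ?subr_lt0// => xy.
  have y0 : ilen i - y < 0 by lra.
  by rewrite /= gt_min y0 orbT.
- exact: edge_point_ge.
Qed.

End HittingEnds.

Section Semigroup.
Context {R : realType} {G : metric_graph R}.
Context {d : measure_display} {Om : measurableType d}.
Variables (P : gpoint G -> probability Om R) (F : R -> set (set Om)).
Variables (X : R -> Om -> cemetery (gpoint G)) (theta : R -> Om -> Om).
Hypothesis bm : brownian_motion P F X theta.
Local Notation U := (transition_semigroup P X).

Lemma Rintegral_off_bad (Q : probability Om R) (g : Om -> R) (c k K : R) (Bad : set Om) :
  measurable Bad -> measurable_fun setT g -> 0 <= k -> (forall w, `|g w - c| <= K) ->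
  (forall w, ~ Bad w -> `|g w - c| <= k) -> `|\int[Q]_w g w - c| <= k + K * pr Q Bad.
Proof.
move=> mB mg k0 gK gk.
have mgc : measurable_fun setT (fun w => g w - c) by exact: measurable_funB.
have igc D : measurable D -> Q.-integrable D (EFin \o (fun w => g w - c)).
  by move=> mD; exact: bounded_integrable gK.
have ig : Q.-integrable setT (EFin \o g).
  apply: (@bounded_integrable _ _ _ _ _ _ (K + `|c|)) => // w.
  by rewrite -{1}(subrK c (g w)) (le_trans (ler_normD _ _))// lerD2r.
have ic : Q.-integrable setT (EFin \o cst c).
  by apply: (@bounded_integrable _ _ _ _ _ _ `|c|).
have -> : \int[Q]_w g w - c = \int[Q]_w (g w - c).
  have Q1 : pr Q setT = 1 by rewrite /pr probability_setT.
  by rewrite RintegralB// Rintegral_cst// -[fine _]/(pr Q setT) Q1 mulr1.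
rewrite (Rintegral_setC_split mB (igc _ measurableT)) addrC.
rewrite (le_trans (ler_normD _ _))// lerD//.
  apply: (le_trans (Rintegral_norm_le (measurableC mB) (igc _ (measurableC mB)) gk)).
  by rewrite ler_piMr// pr_le1//; exact: measurableC.
by apply: Rintegral_norm_le => //; exact: igc.
Qed.

(** If [H] is at most [delta], the Markov property at [H] replaces [f (X t)] by
    [U r f (X H)] at the cost [k]; otherwise [f (X t)] is kept. The resulting
    function is close to [c] off [Bad]. *)
Lemma first_passage (H : Om -> \bar R) (f : gpoint G -> R) (xi : gpoint G)
    (M delta t r c k k' : R) (Bad : set Om) :
  stopping_time F H -> C0 f -> 0 <= M -> (forall p, `|f p| <= M) -> `|c| <= M ->
  0 <= delta -> delta <= t -> 0 <= r -> 0 <= k -> 0 <= k' ->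
  (forall w s, (H w <= delta%:E)%E -> t - delta <= s -> s <= t ->
     `|predicted P X H f s w - predicted P X H f r w| <= k) ->
  measurable Bad ->
  (forall w, ~ Bad w -> (H w <= delta%:E)%E -> `|predicted P X H f r w - c| <= k') ->
  (forall w, ~ Bad w -> (delta%:E < H w)%E -> `|ext0 f (X t w) - c| <= k') ->
  `|U t f xi - c| <= k + (k' + (M + M) * pr (P xi) Bad).
Proof.
move=> sH fC M0 fM cM delta0 deltat r0 k0 k'0 close mBad hle hgt.
have t0 : 0 <= t by exact: le_trans deltat.
pose B := [set w | (H w <= delta%:E)%E].
have mB : measurable B by have [] := stopped_sigma_le bm sH delta.
have cmp := markov_compare bm sH xi fC delta0 deltat r0 k0 close.
pose g w := \1_B w * predicted P X H f r w + \1_(~` B) w * ext0 f (X t w).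
have gB w : B w -> g w = predicted P X H f r w.
  by move=> Bw; rewrite /g !indicE mem_set// memNset// mul1r mul0r addr0.
have gNB w : ~ B w -> g w = ext0 f (X t w).
  by move=> Bw; rewrite /g !indicE memNset// mem_set// mul1r mul0r add0r.
have [_ ipred _] := markov_integrals bm sH xi fC r0.
have mpred : measurable_fun setT (predicted P X H f r).
  by apply/measurable_EFinP; exact: measurable_int ipred.
have mX := ext0_path_measurable bm fC t0.
have mg : measurable_fun setT g.
  by apply: measurable_funD; apply: measurable_funM => //; apply: measurable_indic => //; exact: measurableC.
have predM w : `|predicted P X H f r w| <= M.
  by apply: ext0_norm_le => // p; apply: (semigroup_norm_le bm).
have XM w : `|ext0 f (X t w)| <= M by exact: ext0_norm_le.
have gM w : `|g w| <= M.
  by have [Bw|Bw] := pselect (B w); [rewrite gB|rewrite gNB].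
have gcM w : `|g w - c| <= M + M by rewrite (le_trans (ler_normB _ _))// lerD.
have ig : (P xi).-integrable setT (EFin \o g) by exact: bounded_integrable gM.
have iX := ext0_path_integrable bm xi fC t0.
have e1 : U t f xi - \int[P xi]_w g w =
    \int[P xi]_(w in B) (ext0 f (X t w) - predicted P X H f r w).
  rewrite semigroupE -RintegralB//.
  have iD : (P xi).-integrable setT (EFin \o (fun w => ext0 f (X t w) - g w)).
    by have := integrableB measurableT iX ig; apply: eq_integrable.
  rewrite (Rintegral_setC_split mB iD) [X in _ + X](_ : _ = 0) ?addr0; last first.
    rewrite (@eq_Rintegral _ _ _ _ _ (cst 0)) ?Rintegral_cst ?mul0r//; first exact: measurableC.
    by move=> w; rewrite inE => /gNB ->; rewrite subrr.
  by apply: eq_Rintegral => w; rewrite inE => /gB ->.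
rewrite -(subrKA (\int[P xi]_w g w)) (le_trans (ler_normD _ _))// lerD ?e1//.
apply: Rintegral_off_bad => // w nB.
have [Bw|Bw] := pselect (B w); first by rewrite gB// hle.
by rewrite gNB// hgt// ltNge; apply/negP.
Qed.

(** Right continuity of the paths gives right continuity at time zero, for each
    starting point separately. *)
Lemma semigroup_right_continuous0 (f : gpoint G -> R) (xi : gpoint G) : C0 f ->
  U t f xi @[t --> 0^'+] --> f xi.
Proof.
move=> fC; have [M M0 fM] := C0_bounded fC.
apply/cvg_at_rightP => u [u0 ucvg].
rewrite -(semigroup0 bm xi fC) (semigroupE P X 0 f xi).
under eq_fun do rewrite semigroupE.
apply: (@bounded_convergence _ _ _ (P xi) setT (fun n w => ext0 f (X (u n) w)) _ M) => //.
- by move=> n; apply: (ext0_path_measurable bm fC); exact: ltW.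
- by move=> n w; apply: ext0_norm_le => //; exact: ltW.
- exact: (ext0_path_measurable bm fC).
move=> w _.
have fcont : continuous (ext0 f) by apply: ext0_continuous; case: fC.
have rc : ext0 f (X s w) @[s --> 0^'+] --> ext0 f (X 0 w).
  by apply: (path_right_continuous bm).
by move/cvg_at_rightP: rc; apply.
Qed.

Lemma vertices_short_time (f : gpoint G -> R) (e : R) : C0 f -> 0 < e ->
  exists2 t0, 0 < t0 & forall (v : vertex G) s, 0 <= s -> s <= t0 ->
    `|U s f (Vertex v) - f (Vertex v)| <= e.
Proof.
move=> fC e0; apply: finite_pos_min => [v a b b0 ba h s s0 sb|v].
  by apply: h => //; exact: le_trans ba.
have /cvgrPdist_le/(_ e e0)[eta /= eta0 h] := @semigroup_right_continuous0 f (Vertex v) fC.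
exists (eta / 2); first by rewrite divr_gt0.
move=> s; rewrite le_eqVlt => /orP[/eqP <- _|s0 se].
  by rewrite (semigroup0 bm)// subrr normr0 ltW.
rewrite distrC; apply: h => //; rewrite /ball/= sub0r normrN gtr0_norm//.
by rewrite (le_lt_trans se)// ltr_pdivrMr// ltr_pMr// ltr1n.
Qed.

(** Short-time continuity, uniform in the starting point: stop at the vertices,
    use uniform continuity of [f] and the oscillation bound before, and the
    finitely many vertices afterwards. *)
Lemma strong_continuity (f : gpoint G -> R) (e : R) : C0 f -> 0 < e ->
  exists2 t0, 0 < t0 & forall t xi, 0 <= t -> t <= t0 -> `|U t f xi - f xi| <= e.
Proof.
move=> fC e0; have [M M0 fM] := C0_bounded fC.
have e30 : 0 < e / 3 by rewrite divr_gt0.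
have [eta eta0 feta] := C0_uniform fC e30.
have [t1 t10 hv] := vertices_short_time fC e30.
have eta20 : 0 < eta / 2 by rewrite divr_gt0.
have c0 : 0 <= (M + M) * oscillation_const (eta / 2).
  by rewrite mulr_ge0 ?addr_ge0 ?(ltW M0)// oscillation_const_ge0.
have [t2 [t20 t2t1 ht2]] := exists_short_time c0 e30 t10.
exists t2 => // t xi; rewrite le_eqVlt => /orP[/eqP <- _|t0 tt2].
  by rewrite (semigroup0 bm)// subrr normr0 ltW.
case: xi => [v|l x lx].
  rewrite (le_trans (hv v t (ltW t0) (le_trans tt2 t2t1)))//.
  by rewrite ler_pdivrMr// ler_peMr// ?ltW// ltr1n.
pose Mset : set R := [set y | `|y - f (Inner lx)| <= e / 3].
have mM : measurable Mset.
  apply: measurable_le_set => //; apply: measurableT_comp => //; exact: measurable_funB.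
have fcont : continuous (ext0 f) by apply: ext0_continuous; case: fC.
have [|Bad [mB pB hB]] := graph_stays_close bm lx t0 eta20 fcont mM.
  move=> y yx; rewrite /Mset/= distrC -edge_point_inner; apply: feta.
  apply: gball_edge_point; rewrite distrC (le_lt_trans yx)//.
  by rewrite ltr_pdivrMr// ltr_pMr// ltr1n.
have H0 w : (0 <= vertex_time X w)%E by exact: hitting_time_ge0.
have at_vertex w : (vertex_time X w <= t%:E)%E ->
    exists2 v, at_time X (vertex_time X) w = Some (Vertex v) &
    stopped X (vertex_time X) t w = Some (Vertex v).
  move=> Ht; have E := stopped_at_le (H0 w) Ht.
  have [v _ vE] := vertex_time_fin bm (esym E).
  by exists v; [rewrite /at_time -E -vE|rewrite stoppedE -vE].
have := @first_passage (vertex_time X) f (Inner lx) M t t 0 (f (Inner lx)) (e / 3) (e / 3) Bad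
  (vertex_time_stopping bm) fC (ltW M0) fM (fM _) (ltW t0) (lexx t) (lexx 0) (ltW e30) (ltW e30).
move=> /(_ _ mB _ _)/le_trans; apply.
- move=> w s Ht; rewrite subrr => s0 st; have [v vE _] := at_vertex w Ht.
  rewrite /predicted vE /= (semigroup0 bm)//; apply: hv => //.
  by rewrite (le_trans st)// (le_trans tt2).
- move=> w nB Ht; have [v vE sE] := at_vertex w Ht.
  by have := hB w nB; rewrite sE /predicted vE /= (semigroup0 bm).
- move=> w nB tH; have := hB w nB; rewrite stoppedE stopped_at_ge//; exact: ltW.
have : (M + M) * pr (P (Inner lx)) Bad <= e / 3.
  have MM0 : 0 <= M + M by rewrite addr_ge0 ?(ltW M0).
  apply: (le_trans (ler_wpM2l MM0 pB)); rewrite mulrA.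
  exact: ht2 (ltW t0) tt2.
lra.
Qed.

End Semigroup.

(** * The Feller property *)

Section Feller.
Context {R : realType} {G : metric_graph R}.
Context {d : measure_display} {Om : measurableType d}.
Variables (P : gpoint G -> probability Om R) (F : R -> set (set Om)).
Variables (X : R -> Om -> cemetery (gpoint G)) (theta : R -> Om -> Om).
Hypothesis bm : brownian_motion P F X theta.
Local Notation U := (transition_semigroup P X).

(** The identity of Chapman and Kolmogorov, from the Markov property at a
    constant time. *)
Lemma semigroup_markov (f : gpoint G -> R) (s t : R) (xi : gpoint G) :
  C0 f -> 0 <= s -> 0 <= t ->
  (P xi).-integrable setT (EFin \o (fun w => ext0 (U t f) (X s w))) /\
  U (s + t) f xi = \int[P xi]_w ext0 (U t f) (X s w).
Proof.
move=> fC s0 t0; have st := constant_stopping_time bm s0.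
have [_ iP eqA] := markov_integrals bm st xi fC t0; split; first exact: iP.
have sT : stopped_sigma F (fun=> s%:E) setT.
  have := stopped_sigma_le bm st s; congr stopped_sigma; apply/seteqP; split=> // w _ /=.
  exact: lexx.
by rewrite semigroupE; exact: eqA sT.
Qed.

(** By the semigroup property the increment in time at any point is an average
    of increments at time zero, where strong continuity is uniform. *)
Lemma semigroup_time_continuous (f : gpoint G -> R) (e : R) : C0 f -> 0 < e ->
  exists2 h, 0 < h & forall s t xi, 0 <= s -> s <= t -> t <= s + h ->
    `|U t f xi - U s f xi| <= e.
Proof.
move=> fC e0; have [h h0 hf] := strong_continuity bm fC e0.
exists h => // s t xi s0 st th; have ts0 : 0 <= t - s by rewrite subr_ge0.
have [iU UE] := semigroup_markov xi fC s0 ts0.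
have -> : t = s + (t - s) by rewrite addrC subrK.
rewrite UE semigroupE -RintegralB//; last exact: (ext0_path_integrable bm).
have iD : (P xi).-integrable setT
    (EFin \o (fun w => ext0 (U (t - s) f) (X s w) - ext0 f (X s w))).
  by have := integrableB measurableT iU (ext0_path_integrable bm xi fC s0); apply: eq_integrable.
apply: (@le_trans _ _ (e * pr (P xi) setT)); last by rewrite ler_piMr ?pr_le1// ltW.
apply: Rintegral_norm_le => // w _; case: (X s w) => [p|] /=; last by rewrite subrr normr0 ltW.
by apply: hf => //; rewrite lerBlDl.
Qed.

(** Started close to [p0] the process soon hits [p0], and from there on it
    behaves as if started at [p0], up to a short delay. *)
Lemma semigroup_continuous (f : gpoint G -> R) (t : R) : C0 f -> 0 <= t ->
  continuous (U t f : gpoint G -> R).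
Proof.
move=> fC; rewrite le_eqVlt => /orP[/eqP <-|t0].
  have -> : U 0 f = f by apply/funext => xi; exact: (semigroup0 bm).
  by case: fC.
have [M M0 fM] := C0_bounded fC.
apply: continuous_along_edges => l x0 lx0 e e0.
have e30 : 0 < e / 3 by rewrite divr_gt0.
have [h h0 hU] := semigroup_time_continuous fC e30.
pose delta := Num.min t h; have delta0 : 0 < delta by rewrite lt_min t0.
have dt : delta <= t by rewrite ge_min lexx.
have dh : delta <= h by rewrite ge_min lexx orbT.
have MM0 : 0 < M + M by rewrite addr_gt0.
have [eta eta0 heta] := hits_edge_point_soon bm lx0 delta0 (divr_gt0 e30 MM0).
exists eta => // x lx xx0; have [->|xn] := eqVneq x x0; first by rewrite subrr normr0.
pose p0 := edge_point l x0.
have [a [b [m [anchor [m0 ab _ ab0 _]]]]] := local_distance p0.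
pose psi : cemetery (gpoint G) -> R := extc 1 (glue a b).
have psic : continuous psi by apply: extc_continuous; exact: glue_continuous.
have psi0 p : psi p = 0 <-> p = Some p0.
  case: p => [p|]; first by rewrite /psi/= ab0; split=> [->|[]].
  by split=> // /eqP; rewrite /= oner_eq0.
have [Bad [mB pB hB]] := heta x lx xx0 xn psi psic psi0.
have sH : stopping_time F (zero_time X psi) by apply: (zero_time_stopping bm) => //; rewrite /= oner_neq0.
have at_p0 w : (zero_time X psi w <= delta%:E)%E ->
    at_time X (zero_time X psi) w = Some p0.
  have := sH.1 w; rewrite /at_time; case Hw: (zero_time X psi w) => [s| |]// _ _.
  by apply/psi0; exact: (zero_time_fin bm psic Hw).
have cM : `|U t f p0| <= M by apply: (semigroup_norm_le bm) => //; exact: ltW.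
have := @first_passage _ _ _ _ _ _ _ _ bm (zero_time X psi) f (Inner lx) M delta t t
  (U t f p0) (e / 3) 0 Bad sH fC (ltW M0) fM cM (ltW delta0) dt (ltW t0) (ltW e30) (lexx 0).
rewrite -edge_point_inner => fp; rewrite edge_point_inner in pB *.
apply: (@le_lt_trans _ _ (e / 3 + (0 + (M + M) * pr (P (Inner lx)) Bad))); last first.
  have : (M + M) * pr (P (Inner lx)) Bad <= e / 3.
    by rewrite mulrC -ler_pdivlMr.
  lra.
rewrite edge_point_inner in fp; apply: fp => //.
- move=> w s Hd sl st; rewrite /predicted (at_p0 w Hd) /= distrC.
  have s0 : 0 <= s by rewrite (le_trans _ sl)// subr_ge0.
  apply: hU => //; move: sl dh; lra.
- by move=> w nB Hd; rewrite /predicted (at_p0 w Hd) /= subrr normr0.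
- by move=> w nB; rewrite ltNge (hB w nB).
Qed.

Lemma radius_edge_point (l : edge G) (x : R) : x \in edge_interior l ->
  radius (edge_point l x) = radius_coord l x.
Proof. by move=> lx; rewrite edge_point_inner. Qed.

(** Far out on an external edge the process does not come back in time [t]. *)
Lemma semigroup_vanishes (f : gpoint G -> R) (t e : R) : C0 f -> 0 <= t -> 0 < e ->
  exists M, forall p, M < radius p -> `|U t f p| < e.
Proof.
move=> fC; rewrite le_eqVlt => /orP[/eqP <- e0|t0 e0].
  have [M hM] := C0_radius fC e0; exists M => p /hM.
  by rewrite (semigroup0 bm).
have [M M0 fM] := C0_bounded fC.
have e20 : 0 < e / 2 by rewrite divr_gt0.
have [r0 hr] := C0_radius fC e20.
pose r := Num.max 0 r0; have rr0 : 0 <= r by rewrite le_max lexx.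
have MT : 0 <= M * t ^+ 3 by rewrite mulr_ge0 ?exprn_ge0 ?(ltW M0)// ltW.
have [a a0 ha] := oscillation_const_small MT e20.
exists (r + a + 1) => -[v|[i|ed] x lx] /= xr; try by exfalso; lra.
pose Mset : set R := [set y | r < y].
have mM : measurable Mset by apply: open_measurable; exact: open_gt.
pose rad : cemetery (gpoint G) -> R := extc 0 (@radius R G).
have radc : continuous rad by apply: extc_continuous; exact: radius_continuous.
have [|Bad [mB pB hB]] := graph_stays_close bm lx t0 a0 radc mM.
  move=> y; rewrite ler_norml => /andP[y1 y2].
  have ly : y \in edge_interior (inr ed : edge G) by rewrite itv_edge_interior andbT; lra.
  by rewrite /rad /Mset /= radius_edge_point//=; lra.
rewrite semigroupE -[X in `|X|]subr0.
apply: (@le_lt_trans _ _ (e / 2 + M * pr (P (Inner lx)) Bad)); last first.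
  have := ler_wpM2l (ltW M0) pB; rewrite mulrA mulrAC; lra.
apply: Rintegral_off_bad => //.
- exact: (ext0_path_measurable bm fC (ltW t0)).
- exact: ltW.
- by move=> w; rewrite subr0; apply: ext0_norm_le => //; exact: ltW.
move=> w nB; rewrite subr0; have := hB w nB.
have [Ht|tH] := leP (vertex_time X w) t%:E.
  have E := stopped_at_le (hitting_time_ge0 X (@vertices R G) w) Ht.
  have [v _ vE] := vertex_time_fin bm (esym E).
  by rewrite stoppedE -vE /Mset /rad /= ltNge rr0.
rewrite stoppedE stopped_at_ge; last exact: ltW.
case: (X t w) => [p|] /=; last by rewrite normr0 ltW.
move=> rp; rewrite ltW// hr// (le_lt_trans _ rp)//.
by rewrite le_max lexx orbT.
Qed.

End Feller.

Theorem theorem4p3 (R : realType) (G : metric_graph R)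
    (d : measure_display) (Omega : measurableType d)
    (P : gpoint G -> probability Omega R) (F : R -> set (set Omega))
    (X : R -> Omega -> cemetery (gpoint G)) (theta : R -> Omega -> Omega) :
  brownian_motion P F X theta ->
  feller_semigroup (transition_semigroup P X).
Proof.
move=> bm; split.
- move=> t f t0 fC; apply: C0I; first by apply: (semigroup_continuous bm).
  by move=> e e0; apply: (semigroup_vanishes bm).
- move=> t a f g t0 fC gC; apply/funext => xi; rewrite !semigroupE.
  have iF := ext0_path_integrable bm xi fC t0.
  have iG := ext0_path_integrable bm xi gC t0.
  have iaF : (P xi).-integrable setT (EFin \o (fun w => a * ext0 f (X t w))).
    by have := integrableZl measurableT a iF; apply: eq_integrable.
  rewrite -RintegralZl// -RintegralD//; apply: eq_Rintegral => w _.
  by case: (X t w) => //=; rewrite mulr0 addr0.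
- move=> t f t0 fC f0 xi; rewrite semigroupE; apply: Rintegral_ge0 => w _.
  by case: (X t w) => //=.
- by move=> f fC; apply/funext => xi; exact: (semigroup0 bm).
- move=> t f t0 fC.
  have [M M0 fM] := C0_bounded fC.
  have ub : has_ubound (range (fun x => `|f x|)) by exists M => _ [x _ <-].
  have supf x : `|f x| <= sup_norm f by apply: ub_le_sup => //; exists x.
  have [[x0 _]|no] := pselect (exists x : gpoint G, True); last first.
    rewrite /sup_norm; have E (g : gpoint G -> R) : range g = set0.
      by apply/seteqP; split=> [y [x _ <-]|//]; apply: no; exists x.
    by rewrite !E.
  apply: ge_sup; first by exists `|transition_semigroup P X t f x0|; exists x0.
  move=> _ [x _ <-]; apply: (semigroup_norm_le bm) => //.
  exact: le_trans (normr_ge0 _) (supf x0).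
- move=> s t f s0 t0 fC; apply/funext => xi.
  by rewrite (semigroup_markov bm xi fC t0 s0).2 semigroupE.
move=> f fC; apply/cvgrPdist_le => e e0.
have [t1 t10 ht] := strong_continuity bm fC e0.
near=> t.
have t0 : 0 < t by near: t; exact: nbhs_right_gt.
have tt1 : t <= t1 by near: t; exact: nbhs_right_le.
rewrite sub0r normrN /sup_norm.
have [[x0 _]|no] := pselect (exists x : gpoint G, True); last first.
  have -> : range (fun x => `|transition_semigroup P X t f x - f x|) = set0.
    by apply/seteqP; split=> [y [x _ <-]|//]; apply: no; exists x.
  by rewrite sup0 normr0 ltW.
have ub : ubound (range (fun x => `|transition_semigroup P X t f x - f x|)) e.
  by move=> _ [x _ <-]; apply: ht => //; exact: ltW.
rewrite ger0_norm; first by apply: ge_sup => //; exists `|transition_semigroup P X t f x0 - f x0|; exists x0.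
apply: (le_trans (normr_ge0 (transition_semigroup P X t f x0 - f x0))).
by apply: ub_le_sup; [exists e|exists x0].
Unshelve. all: by end_near. Qed.
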